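(* Let $L>0$, $r>0$, $\theta\in[-1,1]$, $\nu=\sqrt{1-\theta^2}$. Let $\mathcal{S}_d\subset\mathbb{R}^m$ and $\mathcal{S}_u\subset\mathbb{R}^m$ be compact sets, let $\tilde{\mathcal S}_{x,\theta}^r$ be a compact subset of the set $\mathcal{S}_{x,\theta}^r\subset\mathbb{R}^n$ defined in the context, and let $\mathcal{S}_\gamma$ be either a compact subset of $\mathbb{R}$ or $\mathcal{S}_\gamma=\mathbb{R}$. Let $\mathbf{G}\in\mathbb{R}^{m\times n}$, $\mathbf{g},\mathbf{f}\in\mathbb{R}^m$, $\mathbf{h}\in\mathbb{R}^n$ have all their entries independent standard Gaussian, and let $\psi:(\mathbf{d},\mathbf{x},\mathbf{u},\gamma)\mapsto\psi(\mathbf{d},\mathbf{x},\mathbf{u},\gamma)$ be a real-valued continuous function, possibly random but independent of $(\mathbf{G},\mathbf{g},\mathbf{f},\mathbf{h})$. For $(\mathbf{d},\mathbf{x},\mathbf{u},\gamma)\in\mathcal{S}_d\times\tilde{\mathcal S}_{x,\theta}^r\times\mathcal{S}_u\times\mathcal{S}_\gamma$ define $$Y(\mathbf{d},\mathbf{x},\mathbf{u},\gamma)=\mathbf{u}^T\mathbf{G}(\mathbf{x}-r\mathcal{Z}(\mathbf{x}))+\gamma\,\mathbf{u}^T\mathbf{G}\mathcal{Z}(\mathbf{x})+\psi(\mathbf{d},\mathbf{x},\mathbf{u},\gamma)$$ and $$Z(\mathbf{d},\mathbf{x},\mathbf{u},\gamma)=\|\mathbf{x}-r\mathcal{Z}(\mathbf{x})\|\,\mathbf{g}^T\mathbf{u}-\|\mathbf{u}\|\,\mathbf{h}^T(\mathbf{x}-r\mathcal{Z}(\mathbf{x}))+\gamma\|\mathcal{Z}(\mathbf{x})\|(\theta\mathbf{g}+\nu\mathbf{f})^T\mathbf{u}-|\gamma|\,\|\mathbf{u}\|\,\mathbf{h}^T\mathcal{Z}(\mathbf{x})+\psi(\mathbf{d},\mathbf{x},\mathbf{u},\gamma).$$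 Then for any $t\in\mathbb{R}$, $$\mathbb{P}\Big[\min_{\mathbf{d}\in\mathcal{S}_d,\ \mathbf{x}\in\tilde{\mathcal S}_{x,\theta}^r}\ \max_{\mathbf{u}\in\mathcal{S}_u,\ \gamma\in\mathcal{S}_\gamma}Y(\mathbf{d},\mathbf{x},\mathbf{u},\gamma)\le t\Big]\le 4\,\mathbb{P}\Big[\min_{\mathbf{d}\in\mathcal{S}_d,\ \mathbf{x}\in\tilde{\mathcal S}_{x,\theta}^r}\ \max_{\mathbf{u}\in\mathcal{S}_u,\ \gamma\in\mathcal{S}_\gamma}Z(\mathbf{d},\mathbf{x},\mathbf{u},\gamma)\le t\Big].$$
   Context: $\|\cdot\|$ is the Euclidean norm. $\mathbb{R}^n_\star$ is the set of vectors in $\mathbb{R}^n$ with no zero entry. For $\mathbf{x}\in\mathbb{R}^n_\star$, $\mathcal{Z}(\mathbf{x})=L\,\mathrm{sign}(\mathbf{x})$ with $\mathrm{sign}$ applied entrywise, and $$\rho_r(\mathbf{x})=\frac{(\mathbf{x}-r\mathcal{Z}(\mathbf{x}))^T\mathcal{Z}(\mathbf{x})}{\|\mathbf{x}-r\mathcal{Z}(\mathbf{x})\|\,\|\mathcal{Z}(\mathbf{x})\|}$$ (defined when $\mathbf{x}\neq r\mathcal{Z}(\mathbf{x})$). The set $\mathcal{S}_{x,\theta}^r$ consists of all $\mathbf{x}\in\mathbb{R}^n_\star$ such that $\rho_r(\mathbf{x})=\theta$ and no entry of $\mathbf{x}$ lies in the open interval $(-Lr,Lr)$. All feasible sets are nonempty.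 When $\mathcal{S}_\gamma=\mathbb{R}$ the maximum is understood as a supremum with values in $(-\infty,+\infty]$. *)

(* Defs.v *)
(* MathComp / MathComp-Analysis. *)
From HB Require Import structures.
From mathcomp Require Import all_boot all_order all_algebra.
From mathcomp Require Import all_classical all_reals all_analysis.

Set Implicit Arguments.
Unset Strict Implicit.
Unset Printing Implicit Defensive.

Import Order.TTheory GRing.Theory Num.Theory.
Import numFieldNormedType.Exports.

Local Open Scope classical_set_scope.
Local Open Scope ring_scope.

Section Vectors.
Context {R : realType}.

Definition dot n (u v : 'cV[R]_n) : R := (u^T *m v) 0 0.

(* The library's norm on matrices is the sup norm, hence this definition. *)
Definition enorm n (u : 'cV[R]_n) : R := Num.sqrt (\sum_i u i 0 ^+ 2).

Definition calZ n (L : R) (x : 'cV[R]_n) : 'cV[R]_n := L *: map_mx Num.sg x.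

Definition Rstar n : set 'cV[R]_n := [set x | forall i, x i 0 != 0].

(* Only meaningful when x <> r *: calZ L x; elsewhere it is the junk value
   produced by division by 0, which Sxtheta excludes explicitly. *)
Definition rho n (L r : R) (x : 'cV[R]_n) : R :=
  dot (x - r *: calZ L x) (calZ L x)
  / (enorm (x - r *: calZ L x) * enorm (calZ L x)).

Definition Sxtheta n (L r theta : R) : set 'cV[R]_n :=
  [set x | [/\ Rstar x, x <> r *: calZ L x, rho L r x = theta &
    forall i, x i 0 \notin `]- (L * r), L * r[ ]].

End Vectors.
Arguments Sxtheta {R} n L r theta.

Section Probability.
Context {d : measure_display} {Omega : measurableType d} {R : realType}.
Variable P : probability Omega R.

Definition mutually_independent (I : finType) (X : I -> Omega -> R) : Prop :=
  forall (J : {set I}) (B : I -> set R), (forall i, measurable (B i)) ->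
    P (\bigcap_(i in [set` J]) (X i @^-1` B i))
    = (\prod_(i in J) P (X i @^-1` B i))%E.

Definition iid_std_gaussian (I : finType) (X : I -> Omega -> R) : Prop :=
  [/\ forall i, measurable_fun setT (X i),
      forall i (B : set R), measurable B ->
        P (X i @^-1` B) = normal_prob 0 1 B
    & mutually_independent X].

(* The sigma-algebra generated by the variables X i, i in D. *)
Definition sigma_gen (I : Type) (D : set I) (X : I -> Omega -> R) :
    set (set Omega) :=
  <<s \bigcup_(i in D) preimage_set_system setT (X i) measurable >>.

Definition independent_families (I J : Type) (D : set I) (E : set J)
    (X : I -> Omega -> R) (Y : J -> Omega -> R) : Prop :=
  forall A B, sigma_gen D X A -> sigma_gen E Y B ->
    P (A `&` B) = (P A * P B)%E.

End Probability.

(* All the entries of (G, g, f, h) as one finite family of random variables. *)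
Definition entries (R : realType) (Omega : Type) m n
    (G : Omega -> 'M[R]_(m, n)) (g f : Omega -> 'cV[R]_m)
    (h : Omega -> 'cV[R]_n)
    (k : ('I_m * 'I_n) + ('I_m + ('I_m + 'I_n))) (w : Omega) : R :=
  match k with
  | inl ij => G w ij.1 ij.2
  | inr (inl i) => g w i 0
  | inr (inr (inl i)) => f w i 0
  | inr (inr (inr j)) => h w j 0
  end.

Section Processes.
Context {R : realType} {m n : nat}.

Implicit Types (psi : 'cV[R]_m * 'cV[R]_n * 'cV[R]_m * R -> R) (d u : 'cV[R]_m) (x : 'cV[R]_n) (gamma : R).

Definition procY (L r : R) (G : 'M[R]_(m, n)) psi d x u gamma : R :=
  dot u (G *m (x - r *: calZ L x)) + gamma * dot u (G *m calZ L x)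
  + psi (d, x, u, gamma).

Definition procZ (L r theta nu : R) (g f : 'cV[R]_m) (h : 'cV[R]_n)
    psi d x u gamma : R :=
  enorm (x - r *: calZ L x) * dot g u
  - enorm u * dot h (x - r *: calZ L x)
  + gamma * enorm (calZ L x) * dot (theta *: g + nu *: f) u
  - `|gamma| * enorm u * dot h (calZ L x)
  + psi (d, x, u, gamma).

(* Inf and sup are taken in the extended reals: the sup over an unbounded range
   of gamma may be +oo. Over nonempty compact sets and for a continuous F they
   are the min and max. *)
Definition minmax (Sd : set 'cV[R]_m) (Sx : set 'cV[R]_n) (Su : set 'cV[R]_m)
    (Sgamma : set R) (F : 'cV[R]_m -> 'cV[R]_n -> 'cV[R]_m -> R -> R) : \bar R :=
  ereal_inf [set ereal_sup [set (F d x u gamma)%:E | u in Su & gamma in Sgamma]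
            | d in Sd & x in Sx].

End Processes.

(* Main.v *)
(* Put a = x - r Z(x) and b = Z(x), so that Y is the bilinear Gaussian process
   u^T G (a + gamma b) shifted by psi.  Since no entry of x lies in ]- L r, L r[,
   a and b have the same signs entrywise; hence theta >= 0 and
   a.Z(x') <= a.Z(x) = theta |a| |b| for all feasible x, x'.  Adding to Y the term
   |u| ((|a| + |gamma| theta |b|) N1 + |gamma| nu |b| N2), with N1 and N2 fresh
   standard Gaussians, gives it the same covariance as Z between points with equal
   x, and at least that of Z otherwise, so Gordon's min-max comparison applies.
   As theta >= 0, the added term is nonpositive when N1, N2 <= 0, an event of
   probability 1/4: this is the factor 4.

   Gordon's comparison is proved for a smooth min-max functional built from
   sigmoids, by splitting the Gaussian averages over both processes into 2^n
   averages of scale 2^(-n/2) by stability and exchanging them one by one: a second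
   order Taylor expansion of the functional shows that each exchange has the right
   sign up to O(2^(-3n/2)).  For finitely many points the sigmoids are then made
   sharp.  Finally, as (d, x) ranges over a compact set, inf sup <= t holds iff for
   all n some point of a dense sequence satisfies the first n constraints of a
   dense sequence up to 1/n, which reduces the theorem to finitely many points
   whether the range of gamma is bounded or not. *)
Require Import Defs.
From HB Require Import structures.
From mathcomp Require Import all_boot all_order all_algebra.
From mathcomp Require Import all_classical all_reals all_analysis.
From mathcomp Require Import measurable_realfun ring lra.

Set Implicit Arguments.
Unset Strict Implicit.
Unset Printing Implicit Defensive.

Import Order.TTheory GRing.Theory Num.Theory.
Import numFieldNormedType.Exports.

Local Open Scope classical_set_scope.
Local Open Scope ring_scope.

(** * Gaussian integrals on the line *)

(** The Gaussians [N1] and [N2] are never realized on [Omega]. A Gaussian vector is represented by a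
    list of directions [a] in [R^K], standing for the sum of the [z_a a] with independent standard
    Gaussian [z_a]. Expectations are then iterated one-dimensional integrals, and the added term is
    just two more directions in the list for [Y]. No density on [R^K] occurs, so degenerate
    covariances are harmless. The same representation absorbs [psi]: independence turns an
    expectation on [Omega] into an iterated integral started at the random point formed by finitely
    many values of [psi], and the comparison holds from every starting point. Averages can be
    exchanged because they are positive and commute: it is enough to compare second-order terms
    pointwise at the smooth functional itself, and these depend on the directions only through the
    covariance. The sign of the second derivatives is available across rows only, a row being an
    outer point [(d, x)]. Inside a row the covariances are made to agree exactly, variances
    included; this dictates the coefficients of [N1] and [N2]. *)

Section Density.
Context {d} {T : measurableType d} {R : realType}.
Variables (mu nu : {measure set T -> \bar R}) (p : T -> R).
Hypotheses (mp : measurable_fun setT p) (p0 : forall x, 0 <= p x).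
Hypothesis nuE : forall A, measurable A -> (nu A = \int[mu]_(x in A) (p x)%:E)%E.

Import HBNNSimple.
Local Open Scope ereal_scope.

Let integral_density_nnsfun (f : {nnsfun T >-> R}) :
  \int[nu]_x (f x)%:E = \int[mu]_x ((f x)%:E * (p x)%:E).
Proof.
under [LHS]eq_integral do rewrite fimfunE -fsumEFin//.
rewrite [LHS]ge0_integral_fsum//; last 2 first.
  - by move=> r; exact/measurable_EFinP/measurableT_comp.
  - by move=> n x _; rewrite EFinM nnfun_muleindic_ge0.
under [RHS]eq_integral.
  move=> x xD; rewrite fimfunE -fsumEFin// muleC ge0_mule_fsumr; last first.
    by move=> r; rewrite EFinM nnfun_muleindic_ge0.
  over.
rewrite [RHS]ge0_integral_fsum//; last 2 first.
  - move=> r; apply/emeasurable_funM; first exact/measurable_EFinP.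
    exact/measurable_EFinP/measurableT_comp.
  - move=> n x _; rewrite EFinM mule_ge0//; first by rewrite lee_fin.
    by rewrite nnfun_muleindic_ge0.
apply: eq_fsbigr => r _.
have [r0|r0] := leP 0%R r; last first.
  have f0 : f @^-1` [set r] = set0.
    rewrite -subset0 => x /= fxr.
    by have : (0 <= f x)%R by []; rewrite fxr leNgt r0.
  by rewrite f0; under eq_integral do rewrite indic0 mulr0;
    under [RHS]eq_integral do rewrite indic0 mulr0 mule0; rewrite !integral0.
rewrite integralZl_indic_nnsfun// integral_indic// setIT nuE//.
under [RHS]eq_integral do rewrite EFinM muleCA.
rewrite ge0_integralZl//; last 2 first.
- apply/emeasurable_funM; first exact/measurable_EFinP.
  exact/measurable_EFinP.
- by move=> x _; rewrite mule_ge0// lee_fin.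
congr *%E; rewrite integral_mkcond/=; apply: eq_integral => x _.
by rewrite patchE indicE; case: ifPn => _; rewrite ?mule1 ?mule0.
Qed.

Lemma ge0_integral_density (f : T -> \bar R) :
  measurable_fun setT f -> (forall x, 0 <= f x) ->
  \int[nu]_x f x = \int[mu]_x (f x * (p x)%:E).
Proof.
move=> mf f0.
pose f_ := nnsfun_approx measurableT mf.
transitivity (limn (fun n => \int[nu]_x (f_ n x)%:E)).
  rewrite -monotone_convergence//=.
  - apply: eq_integral => ? /[!inE] xD; apply/esym/cvg_lim => //=.
    exact: cvg_nnsfun_approx.
  - by move=> n; exact/measurable_EFinP/measurable_funTS.
  - by move=> n ? _; rewrite lee_fin.
  - by move=> ? _ ? ? mn; rewrite lee_fin; exact/lefP/nd_nnsfun_approx.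
rewrite [RHS](_ : _ = limn (fun n => \int[mu]_x ((f_ n x)%:E * (p x)%:E))).
  by congr (limn _); apply/funext => n; exact: integral_density_nnsfun.
rewrite -monotone_convergence//=.
- apply: eq_integral => x _; apply/esym/cvg_lim => //.
  by apply: cvgeZr => //; exact: cvg_nnsfun_approx.
- move=> n; apply/emeasurable_funM; apply/measurable_EFinP => //.
- by move=> n x _; rewrite mule_ge0// lee_fin.
- move=> x _ m n mn; rewrite lee_wpmul2r// lee_fin//.
  exact/lefP/nd_nnsfun_approx.
Qed.

End Density.

Section ImageMeasure.
Context {d1 d2} {T1 : measurableType d1} {T2 : measurableType d2} {R : realType}.
Variables (m : {measure set T1 -> \bar R}) (g : T1 -> T2).
Hypothesis mg : measurable_fun setT g.

(** [pushforward m g] is a measure only once [g] is known to be measurable, so the structure is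
    cloned here with [mg] supplied. *)
Definition image_measure : {measure set T2 -> \bar R} :=
  ltac:(refine (Measure.clone _ _ _ (pushforward m g) _); exact mg).

Lemma ge0_integral_image_measure (f : T2 -> \bar R) :
  measurable_fun setT f -> (forall x, 0 <= f x)%E ->
  (\int[image_measure]_x f x = \int[m]_x f (g x))%E.
Proof. by move=> mf f0; apply: (ge0_integral_pushforward mg). Qed.

End ImageMeasure.

(** * Lebesgue integrals under affine maps and reflection *)

Section LebesgueAffine.
Context {R : realType}.
Local Notation mu := (@lebesgue_measure R).
Local Open Scope ereal_scope.

Lemma measurable_affine (a b : R) : measurable_fun setT (fun x : measurableTypeR R =>
  a * x + b : measurableTypeR R)%R.
Proof. by apply: measurable_funD => //; exact: measurable_funM. Qed.

(** The preimage of []x, y]] has length [(y - x) / a], so the scaled image measure gives it mass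
    [y - x]; these values determine Lebesgue measure. *)
Lemma lebesgue_measure_affine (a b : R) (a0 : (0 < a)%R) A : measurable A ->
  mu A = mscale (NngNum (ltW a0)) (image_measure mu (measurable_affine a b)) A.
Proof.
apply: lebesgue_measure_unique => // X [[x y] _ <-] /=.
rewrite /mscale /= /pushforward.
rewrite (_ : _ @^-1` _ = `]((x - b) / a)%R, ((y - b) / a)%R]%classic); last first.
  apply/seteqP; split => z; rewrite /= !in_itv /=;
   by rewrite ltr_pdivrMr// ler_pdivlMr// ltrBlDr lerBrDr mulrC.
rewrite !lebesgue_measure_itv/= !lte_fin ltr_pM2r ?invr_gt0// ltrD2r.
case: ifP => _; last by rewrite mule0.
by rewrite -!EFinD -EFinM; congr EFin; field; rewrite gt_eqF.
Qed.

Lemma lebesgue_integral_affine (a b : R) (f : R -> \bar R) : (0 < a)%R ->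
  measurable_fun setT f -> (forall x, 0 <= f x) ->
  \int[mu]_x f x = a%:E * \int[mu]_x f (a * x + b)%R.
Proof.
move=> a0 mf f0.
rewrite (@eq_measure_integral _ _ _ _
  (mscale (NngNum (ltW a0)) (image_measure mu (measurable_affine a b)))).
  by rewrite ge0_integral_mscale// ge0_integral_image_measure.
by move=> A mA _; exact: (lebesgue_measure_affine b a0 mA).
Qed.

Lemma lebesgue_integralN (f : R -> \bar R) :
  measurable_fun setT f -> (forall x, 0 <= f x) ->
  \int[mu]_x f x = \int[mu]_x f (- x)%R.
Proof.
move=> mf f0.
have mg : measurable_fun setT (fun x : measurableTypeR R => - x : measurableTypeR
  R)%R by exact: measurableT_comp.
rewrite (@eq_measure_integral _ _ _ _ (image_measure mu mg)).
  by rewrite ge0_integral_image_measure.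
move=> A mA _; apply: lebesgue_measure_unique => // X [[x y] _ <-] /=.
(* Reflection moves the closed end of []x, y]] to the other side, which does not change the
   length. *)
rewrite /pushforward (_ : _ @^-1` _ = `[(- y)%R, (- x)%R[%classic).
  rewrite !lebesgue_measure_itv/= !lte_fin ltrN2.
  by case: ifP => _ //; rewrite -!EFinD opprK addrC.
apply/seteqP; split => z; rewrite /= !in_itv /= => /andP[h1 h2];
  by apply/andP; split; lra.
Qed.

End LebesgueAffine.

(** * Expectations of bounded measurable functions *)

Section BoundedMeasurable.
Context {d} {T : measurableType d} {R : realType}.

(** A class stable under sums, products, composition and partial averaging, on which every
    probability has finite integrals: real-valued integrals can be manipulated without tracking
    integrability. *)
Definition bounded_mfun (F : T -> R) :=
  measurable_fun setT F /\ exists M, forall x, `|F x| <= M.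

Lemma bounded_mfun_cst c : bounded_mfun (fun=> c).
Proof. by split => //; exists `|c|. Qed.

Lemma bounded_mfunD F G : bounded_mfun F -> bounded_mfun G ->
  bounded_mfun (fun x => F x + G x).
Proof.
move=> [mF [M hM]] [mG [N hN]]; split; first exact: measurable_funD.
by exists (M + N) => x; rewrite (le_trans (ler_normD _ _))// lerD.
Qed.

Lemma bounded_mfunM F G : bounded_mfun F -> bounded_mfun G ->
  bounded_mfun (fun x => F x * G x).
Proof.
move=> [mF [M hM]] [mG [N hN]]; split; first exact: measurable_funM.
by exists (M * N) => x; rewrite normrM ler_pM.
Qed.

Lemma bounded_mfunZ c F : bounded_mfun F -> bounded_mfun (fun x => c * F x).
Proof. exact/bounded_mfunM/bounded_mfun_cst. Qed.

Lemma bounded_mfunB F G : bounded_mfun F -> bounded_mfun G ->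
  bounded_mfun (fun x => F x - G x).
Proof.
move=> bF bG; rewrite (_ : (fun _ => _) = (fun x => F x + (- 1) * G x)).
  by apply: bounded_mfunD => //; exact: bounded_mfunZ.
by apply/funext => x; rewrite mulN1r.
Qed.

Variable P : probability T R.

Lemma bounded_mfun_integrable F : bounded_mfun F ->
  P.-integrable setT (EFin \o F).
Proof.
move=> [mF [M hM]].
apply: measurable_bounded_integrable => //.
  by rewrite (le_lt_trans (probability_le1 _ _))// ltry.
by exists M; split; [exact: num_real|move=> x Mx y _; exact: le_trans (ltW Mx)].
Qed.

Lemma le_Rexp F G : bounded_mfun F -> bounded_mfun G ->
  (forall x, F x <= G x) -> \int[P]_x F x <= \int[P]_x G x.
Proof.
by move=> bF bG FG; apply: le_Rintegral => //; exact: bounded_mfun_integrable.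
Qed.

Lemma Rexp_cst c : \int[P]_x c = c.
Proof.
by rewrite Rintegral_cst// (_ : fine _ = 1) ?mulr1// -[1]/(fine 1%E); congr fine;
  exact: probability_setT.
Qed.

Lemma RexpD F G : bounded_mfun F -> bounded_mfun G ->
  \int[P]_x (F x + G x) = \int[P]_x F x + \int[P]_x G x.
Proof. by move=> bF bG; rewrite RintegralD//; exact: bounded_mfun_integrable. Qed.

Lemma RexpZ c F : bounded_mfun F -> \int[P]_x (c * F x) = c * \int[P]_x F x.
Proof. by move=> bF; rewrite RintegralZl//; exact: bounded_mfun_integrable. Qed.

Lemma EFin_Rexp F : bounded_mfun F ->
  (\int[P]_x F x)%:E = (\int[P]_x (F x)%:E)%E.
Proof.
move=> bF; rewrite /Rintegral fineK//.
by apply: integrable_fin_num => //; exact: bounded_mfun_integrable.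
Qed.

Lemma normr_Rexp F M : bounded_mfun F -> (forall x, `|F x| <= M) ->
  `|\int[P]_x F x| <= M.
Proof.
move=> bF hM; rewrite ler_norml; apply/andP; split.
- rewrite -[leLHS]Rexp_cst; apply: le_Rexp => //; first exact: bounded_mfun_cst.
  by move=> x; have := hM x; rewrite ler_norml => /andP[].
- rewrite -[leRHS]Rexp_cst; apply: le_Rexp => //; first exact: bounded_mfun_cst.
  by move=> x; have := hM x; rewrite ler_norml => /andP[].
Qed.

End BoundedMeasurable.

Lemma bounded_mfun_comp {d1 d2} {T1 : measurableType d1}
    {T2 : measurableType d2} {R : realType} (g : T1 -> T2) (F : T2 -> R) :
  measurable_fun setT g -> bounded_mfun F -> bounded_mfun (F \o g).
Proof.
move=> mg [mF [M hM]]; split; first exact: measurableT_comp.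
by exists M => x; exact: hM.
Qed.

Lemma bounded_mfun_Rexp {d1 d2} {T1 : measurableType d1}
    {T2 : measurableType d2} {R : realType} (P2 : probability T2 R)
    (F : T1 * T2 -> R) :
  bounded_mfun F -> bounded_mfun (fun x => \int[P2]_y F (x, y)).
Proof.
move=> bF; have [mF [M hM]] := bF.
(* Measurability in [x] does not depend on any measure on [T1]; a point mass is chosen only so that
   Fubini applies. *)
pose P1 : probability T1 R := \d_point.
have iF : (P1 \x P2)%E.-integrable setT (EFin \o F).
  exact: (bounded_mfun_integrable (P1 \x P2)%E).
split; last first.
  exists M => x; apply: normr_Rexp => //.
  by apply: (bounded_mfun_comp _ bF); exact: measurable_pair1.
by apply: measurableT_comp => //; exact: (measurable_fubini_F iF).
Qed.

Section BoundedFubini.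
Context {d1 d2} {T1 : measurableType d1} {T2 : measurableType d2} {R : realType}.
Variables (P1 : probability T1 R) (P2 : probability T2 R).
Variable F : T1 * T2 -> R.
Hypothesis bF : bounded_mfun F.

Let iF : (P1 \x P2)%E.-integrable setT (EFin \o F).
Proof. exact: (bounded_mfun_integrable (P1 \x P2)%E). Qed.

Lemma Rexp_prod : \int[P1]_x \int[P2]_y F (x, y) = \int[(P1 \x P2)%E]_z F z.
Proof.
rewrite /Rintegral -(integral12_prod_meas1 iF); congr fine.
apply: eq_integral => x _; rewrite EFin_Rexp//.
by apply: (bounded_mfun_comp _ bF); exact: measurable_pair1.
Qed.

End BoundedFubini.

Lemma Rexp_exchange {d1 d2} {T1 : measurableType d1} {T2 : measurableType d2}
    {R : realType} (P1 : probability T1 R) (P2 : probability T2 R)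
    (F : T1 * T2 -> R) : bounded_mfun F ->
  \int[P1]_x \int[P2]_y F (x, y) = \int[P2]_y \int[P1]_x F (x, y).
Proof.
move=> bF.
have iF : (P1 \x P2)%E.-integrable setT (EFin \o F).
  exact: (bounded_mfun_integrable (P1 \x P2)%E).
have := Fubini iF => FF.
have b1 x : bounded_mfun (fun y => F (x, y)).
  by apply: (bounded_mfun_comp _ bF); exact: measurable_pair1.
have b2 y : bounded_mfun (fun x => F (x, y)).
  by apply: (bounded_mfun_comp _ bF); exact: measurable_pair2.
rewrite /Rintegral; congr fine.
under eq_integral do rewrite -/(Rintegral _ _ _) EFin_Rexp//.
by rewrite FF; apply: eq_integral => y _; rewrite [RHS]EFin_Rexp.
Qed.

(** * The standard Gaussian: symmetry, stability and third moment *)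

Section Gauss.
Context {R : realType}.
Local Notation mu := (@lebesgue_measure R).
Local Notation sqrt2 := (Num.sqrt 2 : R).

Definition gauss : probability (measurableTypeR R) R := normal_prob 0 1.

Local Notation pdf := (normal_pdf (0 : R) 1).

Lemma sqrt2_gt0 : 0 < sqrt2. Proof. by rewrite sqrtr_gt0. Qed.

Lemma sqr_sqrt2 : sqrt2 * sqrt2 = 2.
Proof. by rewrite -expr2 sqr_sqrtr. Qed.

Lemma ge0_integral_gauss (f : R -> \bar R) :
  measurable_fun setT f -> (forall x, 0 <= f x)%E ->
  (\int[gauss]_x f x = \int[mu]_x (f x * (pdf x)%:E))%E.
Proof.
move=> mf f0; apply: ge0_integral_density => //.
  exact: measurable_normal_pdf.
by move=> x; exact: normal_pdf_ge0.
Qed.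

Lemma normal_pdf_opp x : pdf (- x) = pdf x.
Proof. by rewrite !normal_pdfE// /normal_fun !subr0 sqrrN. Qed.

Lemma ge0_integral_gauss_opp (f : R -> \bar R) :
  measurable_fun setT f -> (forall x, 0 <= f x)%E ->
  (\int[gauss]_x f (- x)%R = \int[gauss]_x f x)%E.
Proof.
move=> mf f0; rewrite !ge0_integral_gauss//; last first.
  by apply: measurableT_comp => //; exact: oppr_measurable.
have mg : measurable_fun setT (fun x => f x * (pdf x)%:E)%E.
  by apply: emeasurable_funM => //; apply/measurable_EFinP; exact:
    measurable_normal_pdf.
have g0 x : (0 <= f x * (pdf x)%:E)%E by rewrite mule_ge0// lee_fin normal_pdf_ge0.
apply/esym; apply: (etrans (lebesgue_integralN mg g0)).
by apply: eq_integral => x _; rewrite normal_pdf_opp.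
Qed.

(** Completing the square. The last factor is the density of [z] given [(z + z') / sqrt2 = y], of
    mean [y / sqrt2] and standard deviation [sqrt2^-1]; the leading [sqrt2] is the Jacobian of
    [z' = sqrt2 * y - z]. *)
Lemma normal_pdf_convolution (y z : R) :
  sqrt2 * (pdf z * pdf (sqrt2 * y - z))
  = pdf y * normal_pdf (y / sqrt2) (sqrt2^-1) z.
Proof.
have s0 := sqrt2_gt0.
rewrite !normal_pdfE ?invr_eq0 ?gt_eqF//.
rewrite /normal_peak /normal_fun !subr0.
have -> : sqrt2^-1 ^+ 2 = 2^-1 :> R by rewrite exprVn sqr_sqrtr.
have -> : 2^-1 *+ 2 = 1 :> R by rewrite -[LHS]mulr_natr mulVf.
have -> : (2^-1 * pi *+ 2 : R) = pi by rewrite -[LHS]mulr_natr mulrAC mulVf ?mul1r.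
have -> : (1 ^+ 2 * pi *+ 2 : R) = pi * 2 by rewrite expr1n mul1r mulr_natr.
have -> : (1 ^+ 2 *+ 2 : R) = 2 by rewrite expr1n.
rewrite divr1 (sqrtrM 2 (pi_ge0 R)).
have sp : 0 < Num.sqrt (pi : R) by rewrite sqrtr_gt0 pi_gt0.
have E : expR (- z ^+ 2 / 2) * expR (- (sqrt2 * y - z) ^+ 2 / 2) =
    expR (- y ^+ 2 / 2) * expR (- (z - y / sqrt2) ^+ 2).
  rewrite -!expRD; congr expR.
  have -> : y / sqrt2 = sqrt2 * y / 2.
    have := sqr_sqrt2; move: sqrt2 s0 => s s0 <-.
    by rewrite invfM mulrACA divff ?gt_eqF// mul1r.
  have := sqr_sqrt2; move: sqrt2 => s ss.
  have -> : (s * y - z) ^+ 2 = (s * s) * y ^+ 2 - 2 * s * y * z + z ^+ 2 by ring.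
  have -> : (z - s * y / 2) ^+ 2 = (s * s) * y ^+ 2 / 4 - s * y * z + z ^+ 2 by field.
  by rewrite ss; field.
move: E.
set E1 := expR _; set E2 := expR _; set E3 := expR _; set E4 := expR _ => E.
have [sn pn] : sqrt2 != 0 /\ Num.sqrt (pi : R) != 0 by rewrite !gt_eqF.
rewrite (mulrACA _ E1) E; move: sqrt2 (Num.sqrt pi) sn pn E1 E2 E3 E4 {E sp s0} => s p.
by move=> sn pn _ _ E3 E4; field; rewrite sn pn.
Qed.

(** Substitute [z' = sqrt2 * y - z], exchange the integrals, and integrate out [z]: its conditional
    density given [y] has mass 1. *)
Lemma ge0_integral_gauss_stable (f : R -> \bar R) :
  measurable_fun setT f -> (forall x, 0 <= f x)%E ->
  (\int[gauss]_z \int[gauss]_z' f ((z + z') / sqrt2)%R = \int[gauss]_x f x)%E.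
Proof.
move=> mf f0.
have s0 := sqrt2_gt0.
have mp : measurable_fun setT (fun x => (pdf x)%:E).
  by apply/measurable_EFinP; exact: measurable_normal_pdf.
have mh : measurable_fun setT (fun zz : R * R => f ((zz.1 + zz.2) / sqrt2)%R).
  apply: measurableT_comp => //; apply: measurable_funM => //.
  exact: measurable_funD.
have p0 x : (0 <= (pdf x)%:E)%E by rewrite lee_fin normal_pdf_ge0.
rewrite ge0_integral_gauss; last 2 first.
- apply: (measurable_fun_fubini_tonelli_F (m2 := gauss) (fun zz : R * R => f ((zz.1 +
  zz.2) / sqrt2)%R)) => //.
- by move=> z; exact: integral_ge0.
transitivity (\int[mu]_z \int[mu]_y
    ((sqrt2 * (pdf z * pdf (sqrt2 * y - z)))%:E * f y))%E.
  apply: eq_integral => z _.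
  have mfz : measurable_fun setT (fun y : R => f ((z + y) / sqrt2)%R).
    by apply: measurableT_comp => //; apply: measurable_funM => //;
      exact: measurable_funD.
  rewrite ge0_integral_gauss//.
  rewrite (@lebesgue_integral_affine _ sqrt2 (- z))//; last 2 first.
  - exact: emeasurable_funM.
  - by move=> x; rewrite mule_ge0.
  have mfp : measurable_fun setT (fun x : R => (pdf (sqrt2 * x - z))%:E).
    exact: (measurableT_comp mp (measurable_affine sqrt2 (- z))).
  have -> : (\int[mu]_x (f ((z + (sqrt2 * x - z)) / sqrt2)%R *
      (pdf (sqrt2 * x - z))%:E) =
      \int[mu]_x (f x * (pdf (sqrt2 * x - z))%:E))%E.
    by apply: eq_integral => y _; rewrite addrC subrK mulrAC divff ?gt_eqF// mul1r.
  have mg : measurable_fun setT (fun x => f x * (pdf (sqrt2 * x - z))%:E)%E.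
    exact: emeasurable_funM.
  have g0 x : (0 <= f x * (pdf (sqrt2 * x - z))%:E)%E by rewrite mule_ge0.
  rewrite muleAC -EFinM -ge0_integralZl//; last first.
    by rewrite lee_fin mulr_ge0 ?normal_pdf_ge0// ltW.
  by apply: eq_integral => y _; rewrite (muleC (f y)) muleA -EFinM mulrA.
pose K (zy : R * R) := ((sqrt2 * (pdf zy.1 * pdf (sqrt2 * zy.2 - zy.1)))%:E * f zy.2)%E.
have mK : measurable_fun setT K.
  apply: emeasurable_funM; last exact: (measurableT_comp mf).
  apply/measurable_EFinP; apply: measurable_funM => //; apply: measurable_funM.
    by apply: measurableT_comp => //; exact: measurable_normal_pdf.
  apply: measurableT_comp; first exact: measurable_normal_pdf.
  by apply: measurable_funB => //; exact: measurable_funM.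
have K0 zy : (0 <= K zy)%E.
  by rewrite mule_ge0// lee_fin !mulr_ge0 ?normal_pdf_ge0// ltW.
transitivity (\int[mu]_y \int[mu]_z K (z, y))%E; first by have := fubini_tonelli (m1
  := mu) (m2 := mu) K mK K0; apply.
rewrite ge0_integral_gauss//; apply: eq_integral => y _.
transitivity (\int[mu]_z ((f y * (pdf y)%:E) *
    (normal_pdf (y / sqrt2) (sqrt2^-1) z)%:E))%E.
  by apply: eq_integral => z _; rewrite /K/= normal_pdf_convolution EFinM muleC muleA.
rewrite ge0_integralZl//.
- by rewrite integral_normal_pdf mule1.
- by apply/measurable_EFinP; exact: measurable_normal_pdf.
- by move=> z _; rewrite lee_fin normal_pdf_ge0.
- by rewrite mule_ge0.
Qed.

(** The integrand is dominated by a multiple of the centred normal density [q] of standard deviation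
    [sqrt2], half of the exponent being spent on the cube. With [a = |z|],
    [expR (a^2 / 4) >= (1 + a^2 / 8)^2], and 65 is a comfortable constant:
    [65 (1 + a^2 / 8)^2 >= a^4 + a^2 >= 2 a^3]. *)
Lemma gauss_norm3_lty : (\int[gauss]_z (`|z| ^+ 3)%:E < +oo)%E.
Proof.
have mn : measurable_fun setT (fun z : R => (`|z| ^+ 3)%:E).
  by apply/measurable_EFinP; apply: measurable_funX; exact: normr_measurable.
have n0 (z : R) : (0 <= (`|z| ^+ 3)%:E)%E by rewrite lee_fin exprn_ge0.
have mp : measurable_fun setT (fun x => (pdf x)%:E).
  by apply/measurable_EFinP; exact: measurable_normal_pdf.
rewrite ge0_integral_gauss//.
pose q := normal_pdf (0 : R) sqrt2.
have sn : sqrt2 != 0 by rewrite gt_eqF// sqrt2_gt0.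
pose C := 65 * normal_peak 1 / normal_peak sqrt2.
apply: (@le_lt_trans _ _ (\int[mu]_z (C * q z)%:E)%E); last first.
  under eq_integral do rewrite EFinM.
  rewrite ge0_integralZl//; first by rewrite integral_normal_pdf mule1 ltry.
  - by apply/measurable_EFinP; exact: measurable_normal_pdf.
  - by move=> x _; rewrite lee_fin normal_pdf_ge0.
  - by rewrite lee_fin !mulr_ge0// ?invr_ge0 ?normal_peak_ge0.
apply: ge0_le_integral => //.
- by move=> x _; rewrite mule_ge0// lee_fin normal_pdf_ge0.
- exact: emeasurable_funM.
- apply/measurable_EFinP; apply: measurable_funM => //; exact: measurable_normal_pdf.
move=> z _; rewrite -EFinM lee_fin /C /q !normal_pdfE// /normal_fun !subr0.
have pk : normal_peak sqrt2 != 0 by rewrite gt_eqF ?normal_peak_gt0.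
have -> (a e : R) : 65 * a / normal_peak sqrt2 * (normal_peak sqrt2 * e) = a * (65 * e).
  by field.
rewrite mulrCA ler_pM2l ?normal_peak_gt0 ?oner_neq0//.
have -> : - z ^+ 2 / (1 ^+ 2 *+ 2) = - z ^+ 2 / (sqrt2 ^+ 2 *+ 2) + - (z ^+ 2 / 4).
  by rewrite sqr_sqrtr// expr1n -mulr_natr; field.
rewrite expRD mulrCA mulrC ler_pM2r ?expR_gt0// expRN ler_pdivrMr ?expR_gt0//.
have h1 : (1 + z ^+ 2 / 8) ^+ 2 <= expR (z ^+ 2 / 4).
  have -> : z ^+ 2 / 4 = z ^+ 2 / 8 + z ^+ 2 / 8 by field.
  rewrite expRD -expr2 ler_pXn2r ?nnegrE ?expR_ge0 ?expR_ge1Dx//.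
  by rewrite addr_ge0// divr_ge0// sqr_ge0.
have := normr_ge0 z; rewrite -(real_normK (num_real z)) in h1 *.
move: `|z| h1 => a; move: (expR _) => e h1 a0.
have h2 : 0 <= a ^+ 2 * (a - 1) ^+ 2 by rewrite mulr_ge0// sqr_ge0.
have h3 : 0 <= a ^+ 2 by rewrite sqr_ge0.
have h4 : 0 <= (a ^+ 2) ^+ 2 by rewrite sqr_ge0.
by nra.
Qed.

Implicit Type F : measurableTypeR R -> R.

Lemma bounded_mfun_gaussN F : bounded_mfun F -> bounded_mfun (fun z : measurableTypeR
  R => F (- (z : R))).
Proof.
move=> bF; have mN : measurable_fun setT
  (fun z : measurableTypeR R => - z : measurableTypeR R).
  exact: oppr_measurable.
exact: (bounded_mfun_comp mN bF).
Qed.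

Lemma Rexp_gaussN F : bounded_mfun F ->
  \int[gauss]_z F (- (z : R)) = \int[gauss]_z F z.
Proof.
move=> bF; have [mF [M hM]] := bF.
have bM : bounded_mfun (fun=> M : R) := bounded_mfun_cst M.
(* Adding the bound [M] makes the integrand nonnegative, which is the case already treated. *)
apply: (addIr M); rewrite -(Rexp_cst gauss M) -!RexpD//; last first.
  exact: bounded_mfun_gaussN.
rewrite /Rintegral; congr fine.
rewrite (@ge0_integral_gauss_opp (fun z => (F z + M)%:E))//.
- by apply/measurable_EFinP; exact: measurable_funD.
- by move=> x; rewrite lee_fin; have := hM x; rewrite ler_norml => /andP[]; lra.
Qed.

Lemma Rexp_gauss_stable F : bounded_mfun F ->
  \int[gauss]_z \int[gauss]_z' F ((z + z') / sqrt2) = \int[gauss]_z F z.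
Proof.
move=> bF; have [mF [M hM]] := bF.
have bM d (T : measurableType d) : bounded_mfun (fun=> M : R) := @bounded_mfun_cst d
  T R M.
pose H (zz : measurableTypeR R * measurableTypeR R) : R := F ((zz.1 + zz.2) / sqrt2).
have bH : bounded_mfun H.
  apply: (bounded_mfun_comp _ bF) => //; apply: measurable_funM => //.
  exact: measurable_funD.
have bHM : bounded_mfun (fun x => H x + M) by apply: bounded_mfunD.
have b1 z : bounded_mfun (fun z' => H (z, z')).
  by apply: (bounded_mfun_comp _ bH); exact: measurable_pair1.
have b1M z : bounded_mfun (fun z' => H (z, z') + M) by apply: bounded_mfunD.
have b2 : bounded_mfun (fun z => \int[gauss]_z' H (z, z')) := bounded_mfun_Rexp gauss
  bH.
have E1 : \int[gauss]_z \int[gauss]_z' (H (z, z') + M) =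
    \int[gauss]_z \int[gauss]_z' H (z, z') + M.
  transitivity (\int[gauss]_z (\int[gauss]_z' H (z, z') + M)).
    by apply: eq_Rintegral => z _; rewrite RexpD// Rexp_cst.
  by rewrite (RexpD gauss b2)// Rexp_cst.
have E2 : \int[gauss]_z (F z + M) = \int[gauss]_z F z + M.
  by rewrite RexpD// Rexp_cst.
apply: (addIr M); rewrite -E2 -[LHS]E1 /Rintegral; congr fine.
transitivity (\int[gauss]_z \int[gauss]_z' (H (z, z') + M)%:E)%E.
  by apply: eq_integral => z _; rewrite -[LHS]/(Rintegral _ _ _)%:E EFin_Rexp.
apply: (ge0_integral_gauss_stable (f := fun z => (F z + M)%:E)).
- by apply/measurable_EFinP; exact: measurable_funD.
- by move=> x; rewrite lee_fin; have := hM x; rewrite ler_norml => /andP[]; lra.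
Qed.

Definition gauss_var : R := \int[gauss]_z (z ^+ 2).
Definition gauss_abs3 : R := \int[gauss]_z (`|z : R| ^+ 3).

Let integrable3 : gauss.-integrable setT (EFin \o (fun z => `|z : R| ^+ 3)).
Proof.
apply/integrableP; split.
  by apply/measurable_EFinP; apply: measurable_funX; exact: normr_measurable.
under eq_integral do rewrite /= ger0_norm ?exprn_ge0//.
exact: gauss_norm3_lty.
Qed.

Let integrable1 : gauss.-integrable setT (EFin \o cst (1 : R)).
Proof. exact/bounded_mfun_integrable/bounded_mfun_cst. Qed.

Let integrable2 : gauss.-integrable setT (EFin \o (fun z => (z : R) ^+ 2)).
Proof.
have i13 := integrableD measurableT integrable1 integrable3.
apply: (le_integrable measurableT _ _ i13).
  by apply/measurable_EFinP; exact: measurable_funX.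
move=> z _ /=; rewrite lee_fin normrX.
rewrite [leRHS]ger0_norm ?addr_ge0 ?exprn_ge0//; have := normr_ge0 (z : R).
by move: `|_| => a; have := sqr_ge0 (a - 1); nra.
Qed.

Lemma gauss_var_ge0 : 0 <= gauss_var.
Proof. by apply: Rintegral_ge0 => z _; exact: sqr_ge0. Qed.

Lemma gauss_abs3_ge0 : 0 <= gauss_abs3.
Proof. by apply: Rintegral_ge0 => z _; exact: exprn_ge0. Qed.

(* Averaging F over z and - z removes the first-order term. *)
Lemma gauss_taylor F (a b c C : R) : bounded_mfun F ->
  (forall z : R, `|F z - (a + b * z + c * z ^+ 2)| <= C * `|z| ^+ 3) ->
  `|\int[gauss]_z F z - (a + c * gauss_var)| <= C * gauss_abs3.
Proof.
move=> bF hF.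
have bN := bounded_mfun_gaussN bF.
pose S (z : measurableTypeR R) := 2^-1 * (F z + F (- (z : R))).
have bS : bounded_mfun S by apply: bounded_mfunZ; exact: bounded_mfunD.
have iS := bounded_mfun_integrable gauss bS.
have -> : \int[gauss]_z F z = \int[gauss]_z S z.
  rewrite RexpZ ?RexpD ?Rexp_gaussN//; last exact: bounded_mfunD.
  by move: (\int[_]_z _) => e; field.
pose Q (z : measurableTypeR R) := a * 1 + c * (z : R) ^+ 2.
have ia : gauss.-integrable setT (EFin \o (fun=> a * 1)).
  exact/bounded_mfun_integrable/bounded_mfun_cst.
have ic : gauss.-integrable setT (EFin \o (fun z => c * (z : R) ^+ 2)).
  rewrite (_ : _ \o _ = fun z => c%:E * (EFin \o (fun z => (z : R) ^+ 2)%R) z)%E//.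
  exact: integrableZl.
have iQ : gauss.-integrable setT (EFin \o Q).
  rewrite (_ : EFin \o Q = (EFin \o (fun=> a * 1)%R) \+ (EFin \o (fun z => c * (z :
    R) ^+ 2)%R))%E//.
  exact: integrableD.
have -> : a + c * gauss_var = \int[gauss]_z Q z.
  by rewrite RintegralD// Rexp_cst mulr1 RintegralZl.
rewrite -RintegralB//.
have iSQ : gauss.-integrable setT (EFin \o (fun z => S z - Q z)).
  rewrite (_ : EFin \o _ = (EFin \o S) \- (EFin \o Q))%E//.
  exact: integrableB.
have i3 : gauss.-integrable setT (EFin \o (fun z => C * `|z : R| ^+ 3)).
  rewrite (_ : _ \o _ = fun z => C%:E * (EFin \o (fun z => `|z : R| ^+ 3)%R) z)%E//.
  exact: integrableZl.
rewrite (le_trans (le_normr_Rintegral _ iSQ))// -RintegralZl//.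
apply: le_Rintegral => //.
  rewrite (_ : EFin \o _ = abse \o (EFin \o (fun z => S z - Q z)))//.
  exact: integrable_abse.
move=> z _; have := hF z; have := hF (- (z : R)).
rewrite normrN /S /Q mulr1 sqrrN.
rewrite !ler_norml => /andP[h1 h2] /andP[h3 h4].
by apply/andP; split; lra.
Qed.

End Gauss.

(** * Gaussian averages over lists of directions *)

Section GaussianAverage.
Context {R : realType} {K : nat}.
Local Notation V := (K.-tuple (measurableTypeR R)).
Local Notation sqrt2 := (Num.sqrt 2 : R).
Implicit Types (x a b : V) (f g : V -> R) (A B : seq V).

Definition tcoord x i : R := tnth x i.
Definition tshift x (z : R) a : V := [tuple tcoord x i + z * tcoord a i | i < K].
Definition tscale (c : R) a : V := [tuple c * tcoord a i | i < K].

Lemma tshiftE x z a i : tcoord (tshift x z a) i = tcoord x i + z * tcoord a i.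
Proof. by rewrite /tcoord tnth_mktuple. Qed.

Lemma tscaleE c a i : tcoord (tscale c a) i = c * tcoord a i.
Proof. by rewrite /tcoord tnth_mktuple. Qed.

Lemma tcoord_inj x a : (forall i, tcoord x i = tcoord a i) -> x = a.
Proof. by move=> h; apply: eq_from_tnth => i; exact: h. Qed.

Lemma tshiftC x y z a b : tshift (tshift x y a) z b = tshift (tshift x z b) y a.
Proof. by apply: tcoord_inj => i; rewrite !tshiftE addrAC. Qed.

Lemma measurable_tcoord i : measurable_fun setT (fun x => tcoord x i).
Proof. exact: measurable_tnth. Qed.

Lemma measurable_tuple {d} {T : measurableType d} (X : T -> V) :
  (forall i, measurable_fun setT (fun w => tcoord (X w) i)) ->
  measurable_fun setT X.
Proof. by move=> h; apply/measurable_fun_tnthP => i; exact: h. Qed.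

Lemma measurable_tshift a :
  measurable_fun setT (fun xz : V * measurableTypeR R => tshift xz.1 xz.2 a).
Proof.
apply: measurable_tuple => i; under eq_fun do rewrite tshiftE.
apply: measurable_funD; last exact: measurable_funM.
exact: (measurableT_comp (measurable_tcoord i)).
Qed.

Definition gauss_avg a f x : R := \int[gauss]_z f (tshift x z a).

(** The mean of [f] at [x] plus a Gaussian vector whose covariance at [(p, q)] is the sum over [A]
    of [tcoord a p * tcoord a q]. The head of the list is averaged innermost. *)
Definition gauss_avgs A f : V -> R := foldl (fun g a => gauss_avg a g) f A.

Lemma bounded_mfun_tshift f x a : bounded_mfun f ->
  bounded_mfun (fun z : measurableTypeR R => f (tshift x z a)).
Proof.
move=> bf; apply: (bounded_mfun_comp (g := fun z : measurableTypeR R => tshift x z a)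
  _ bf).
exact: (measurableT_comp (measurable_tshift a) (measurable_pair1 x)).
Qed.

Lemma bounded_mfun_avg f a : bounded_mfun f -> bounded_mfun (gauss_avg a f).
Proof.
move=> bf; pose F (xz : V * measurableTypeR R) := f (tshift xz.1 xz.2 a).
have bF : bounded_mfun F := bounded_mfun_comp (measurable_tshift a) bf.
exact: (bounded_mfun_Rexp gauss bF).
Qed.

Lemma bounded_mfun_avgs f A : bounded_mfun f -> bounded_mfun (gauss_avgs A f).
Proof.
by elim: A f => //= a A IH f bf; apply: IH; exact: bounded_mfun_avg.
Qed.

Lemma gauss_avgC a b f : bounded_mfun f ->
  gauss_avg a (gauss_avg b f) = gauss_avg b (gauss_avg a f).
Proof.
move=> bf; apply/funext => x.
pose F (yz : measurableTypeR R * measurableTypeR R) := f (tshift (tshift x yz.1 a)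
  yz.2 b).
have bF : bounded_mfun F.
  apply: (bounded_mfun_comp _ bf); apply: measurable_tuple => i.
  under eq_fun do rewrite !tshiftE.
  by apply: measurable_funD; [apply: measurable_funD|]; rewrite //; exact:
    measurable_funM.
rewrite /gauss_avg -[LHS]/(\int[gauss]_y \int[gauss]_z F (y, z)).
rewrite Rexp_exchange//; apply: eq_Rintegral => z _; apply: eq_Rintegral => y _.
by rewrite /F /= tshiftC.
Qed.

Lemma gauss_avg_half a f : bounded_mfun f ->
  gauss_avg a f =
  gauss_avg (tscale sqrt2^-1 a) (gauss_avg (tscale sqrt2^-1 a) f).
Proof.
move=> bf; apply/funext => x.
rewrite /gauss_avg -(Rexp_gauss_stable (bounded_mfun_tshift x a bf)).
apply: eq_Rintegral => y _; apply: eq_Rintegral => z _; congr f.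
by apply: tcoord_inj => i; rewrite !tshiftE !tscaleE; ring.
Qed.

Lemma le_gauss_avg a f g : bounded_mfun f -> bounded_mfun g ->
  (forall x, f x <= g x) -> forall x, gauss_avg a f x <= gauss_avg a g x.
Proof.
by move=> bf bg fg x; apply: le_Rexp => //; exact: bounded_mfun_tshift.
Qed.

Lemma gauss_avg_cst a c : gauss_avg a (fun=> c) = fun=> c.
Proof. by apply/funext => x; rewrite /gauss_avg Rexp_cst. Qed.

Lemma gauss_avgD a f g : bounded_mfun f -> bounded_mfun g ->
  gauss_avg a (fun x => f x + g x) = fun x => gauss_avg a f x + gauss_avg a g x.
Proof.
by move=> bf bg; apply/funext => x; apply: RexpD; exact: bounded_mfun_tshift.
Qed.

Lemma gauss_avgZ a c f : bounded_mfun f ->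
  gauss_avg a (fun x => c * f x) = fun x => c * gauss_avg a f x.
Proof.
by move=> bf; apply/funext => x; apply: RexpZ; exact: bounded_mfun_tshift.
Qed.

Lemma le_gauss_avgs A f g : bounded_mfun f -> bounded_mfun g ->
  (forall x, f x <= g x) -> forall x, gauss_avgs A f x <= gauss_avgs A g x.
Proof.
elim: A f g => //= a A IH f g bf bg fg; apply: IH; try exact: bounded_mfun_avg.
exact: le_gauss_avg.
Qed.

Lemma gauss_avgs_cst A c : gauss_avgs A (fun=> c) = fun=> c.
Proof. by elim: A => //= a A IH; rewrite gauss_avg_cst. Qed.

Lemma gauss_avgsD A f g : bounded_mfun f -> bounded_mfun g ->
  gauss_avgs A (fun x => f x + g x) = fun x => gauss_avgs A f x + gauss_avgs A g x.
Proof.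
elim: A f g => //= a A IH f g bf bg.
by rewrite gauss_avgD// IH//; exact: bounded_mfun_avg.
Qed.

Lemma gauss_avgsZ A c f : bounded_mfun f ->
  gauss_avgs A (fun x => c * f x) = fun x => c * gauss_avgs A f x.
Proof.
elim: A f => //= a A IH f bf.
by rewrite gauss_avgZ// IH//; exact: bounded_mfun_avg.
Qed.

Lemma gauss_avgs_avgC A b f : bounded_mfun f ->
  gauss_avgs A (gauss_avg b f) = gauss_avg b (gauss_avgs A f).
Proof.
elim: A f => //= a A IH f bf.
by rewrite gauss_avgC// IH//; exact: bounded_mfun_avg.
Qed.

Lemma gauss_avgsC A B f : bounded_mfun f ->
  gauss_avgs A (gauss_avgs B f) = gauss_avgs B (gauss_avgs A f).
Proof.
elim: A f => //= a A IH f bf.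
by rewrite -gauss_avgs_avgC// IH//; exact: bounded_mfun_avg.
Qed.

Lemma gauss_avgs_half A f : bounded_mfun f ->
  gauss_avgs A f =
  gauss_avgs (map (tscale sqrt2^-1) A) (gauss_avgs (map (tscale sqrt2^-1) A) f).
Proof.
elim: A f => //= a A IH f bf.
set a' := tscale _ a; set A' := map _ A.
have bf' : bounded_mfun (gauss_avg a' f) := bounded_mfun_avg a' bf.
rewrite (gauss_avg_half a bf) IH -/A'; last exact: bounded_mfun_avg.
by congr (gauss_avgs A' _); exact: gauss_avgs_avgC.
Qed.

(** With [S] and [T] the averages over the half lists, the claim reads [S S f <= T T f + 2 e]. By
    positivity and commutation, [S S f <= S T f + e = T S f + e <= T T f + 2 e]. *)
Lemma le_gauss_avgs_double A B f (e : R) : bounded_mfun f ->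
  (forall x, gauss_avgs (map (tscale sqrt2^-1) A) f x <=
     gauss_avgs (map (tscale sqrt2^-1) B) f x + e) ->
  forall x, gauss_avgs A f x <= gauss_avgs B f x + 2 * e.
Proof.
move=> bf h x; rewrite gauss_avgs_half// [in leRHS]gauss_avgs_half//.
set A' := map _ A; set B' := map _ B.
have bA := bounded_mfun_avgs A' bf; have bB := bounded_mfun_avgs B' bf.
have be : bounded_mfun (fun _ : V => e) by exact: bounded_mfun_cst.
apply: (@le_trans _ _ (gauss_avgs A' (fun x => gauss_avgs B' f x + e) x)).
  by apply: le_gauss_avgs => //; exact: bounded_mfunD.
rewrite gauss_avgsD// gauss_avgs_cst gauss_avgsC// mulr2n mulrDl mul1r addrA lerD2r.
apply: (@le_trans _ _ (gauss_avgs B' (fun x => gauss_avgs B' f x + e) x)).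
  by apply: le_gauss_avgs => //; exact: bounded_mfunD.
by rewrite gauss_avgsD// gauss_avgs_cst.
Qed.

Lemma map_tscale c1 c2 A :
  map (tscale c1) (map (tscale c2) A) = map (tscale (c2 * c1)) A.
Proof.
rewrite -map_comp; apply: eq_map => a; apply: tcoord_inj => i.
by rewrite /= !tscaleE mulrA (mulrC c1).
Qed.

Lemma map_tscale1 A : map (tscale 1) A = A.
Proof.
by rewrite -[RHS]map_id; apply: eq_map => a; apply: tcoord_inj => i; rewrite tscaleE
  mul1r.
Qed.

(* At scale 2^(-n/2) the error is C 2^(-3n/2), and 2^n such errors add up. *)
Lemma le_gauss_avgs_scale A B f (C : R) : bounded_mfun f ->
  (forall c x, 0 <= c -> c <= 1 -> gauss_avgs (map (tscale c) A) f x <=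
     gauss_avgs (map (tscale c) B) f x + C * c ^+ 3) ->
  forall x, gauss_avgs A f x <= gauss_avgs B f x.
Proof.
move=> bf h x.
pose s : R := sqrt2^-1.
have s2 : 2 * (s * s) = 1 by rewrite /s -invfM sqr_sqrt2 divff.
have s0 : 0 <= s by rewrite invr_ge0 ltW// sqrt2_gt0.
have s1 : s < 1 by nra.
have H n : gauss_avgs A f x <= gauss_avgs B f x + 2 ^+ n * (C * (s ^+ n) ^+ 3).
  have : forall y, gauss_avgs (map (tscale (s ^+ n)) A) f y <=
      gauss_avgs (map (tscale (s ^+ n)) B) f y + C * (s ^+ n) ^+ 3.
    by move=> y; apply: h; [exact: exprn_ge0|apply: exprn_ile1 => //; exact: ltW].
  move: (C * _) => e; elim: n e x => [|n IH] e x he.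
    by rewrite expr0 mul1r; have := he x; rewrite !map_tscale1.
  rewrite exprSr -mulrA; apply: IH => {}x.
  apply: le_gauss_avgs_double => // y.
  by rewrite !map_tscale -exprSr.
have {}H n : gauss_avgs A f x - gauss_avgs B f x <= C * s ^+ n.
  have := H n; rewrite lerBlDl.
  by rewrite mulrCA -exprM mulnC exprM -exprMn exprSr expr2 mulrA s2 mul1r.
have cv : C * s ^+ n @[n --> \oo] --> C * 0.
  by apply: cvgMr; apply: cvg_expr; rewrite ger0_norm.
rewrite -subr_le0 -(mulr0 C) -(cvg_lim _ cv)//.
apply: limr_ge; first by apply/cvg_ex; exists (C * 0).
by apply: nearW => n; exact: H.
Qed.

End GaussianAverage.

(** * Second-order Taylor expansion with a uniform remainder *)

Section Taylor.
Context {R : realType}.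

(** The mean value theorem replaces integration. It loses the factor [1 / n.+1], but only the order
    of the remainder matters below. *)
Lemma derive_bound_integrate (f df : R -> R) (M : R) (n : nat) :
  (forall y : R, is_derive y 1 f (df y)) -> f 0 = 0 ->
  (forall y, `|df y| <= M * `|y| ^+ n) -> forall z, `|f z| <= M * `|z| ^+ n.+1.
Proof.
move=> fdf f0 dfM z.
have M0 : 0 <= M by have := le_trans (normr_ge0 _) (dfM 1); rewrite normr1 expr1n mulr1.
have cf a b : {within `[a, b], continuous f}.
  apply: derivable_within_continuous => y _.
  exact: (@ex_derive _ _ _ _ _ _ _ (fdf y)).
have key c : `|c| <= `|z| -> `|df c * z| <= M * `|z| ^+ n.+1.
  move=> cz; rewrite normrM exprSr mulrA ler_wpM2r//.
  by rewrite (le_trans (dfM c))// ler_wpM2l//; apply: lerXn2r; rewrite ?nnegrE.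
have [z0|z0|->] := ltgtP z 0.
- have [c] := MVT z0 (fun y _ => fdf y) (cf _ _).
  rewrite in_itv/= => /andP[zc c0]; rewrite f0 !sub0r => fz.
  rewrite -normrN fz -normrN -mulrN opprK; apply: key.
  by rewrite !ltr0_norm// lerN2 ltW.
- have [c] := MVT z0 (fun y _ => fdf y) (cf _ _).
  rewrite in_itv/= => /andP[c0 cz]; rewrite f0 !subr0 => ->; apply: key.
  by rewrite !gtr0_norm// ltW.
- by rewrite f0 normr0 mulr_ge0// exprn_ge0.
Qed.

Lemma taylor3 (f0 f1 f2 f3 : R -> R) (M : R) :
  (forall y : R, is_derive y 1 f0 (f1 y)) -> (forall y : R, is_derive y 1 f1 (f2 y)) ->
  (forall y : R, is_derive y 1 f2 (f3 y)) -> (forall y, `|f3 y| <= M) ->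
  forall z, `|f0 z - (f0 0 + f1 0 * z + f2 0 / 2 * z ^+ 2)| <= M * `|z| ^+ 3.
Proof.
move=> d0 d1 d2 hM z.
have h2 := @derive_bound_integrate (fun z => f2 z - f2 0) f3 M 0.
have h1 := @derive_bound_integrate (fun z => f1 z - f1 0 - f2 0 * z) (fun z => f2 z -
  f2 0) M 1.
apply: (@derive_bound_integrate (fun z => f0 z - (f0 0 + f1 0 * z + f2 0 / 2 * z ^+ 2))
  (fun z => f1 z - f1 0 - f2 0 * z) M 2) => [y||].
- apply: is_derive_eq.
  by rewrite /GRing.scale/=; field.
- by rewrite !(mulr0, addr0, expr0n, subrr).
apply: h1 => [y||]; last 2 first.
- by rewrite mulr0 subr0 subrr.
- apply: h2 => [y||y]; last 2 first.
  + by rewrite subrr.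
  + by rewrite expr0 mulr1.
  + by apply: is_derive_eq; rewrite subr0.
- by apply: is_derive_eq; rewrite /GRing.scale/=; ring.
Qed.

End Taylor.

(** * Gordon's comparison for a smooth min-max *)

Section SigmoidExpressions.
Context {R : realType} {K : nat}.
Local Notation V := (K.-tuple (measurableTypeR R)).
Variables (k t0 : R).
Implicit Types (x a b : V) (p q : 'I_K) (A B : seq V).

(** For [k > 0] a smooth decreasing substitute for the indicator of [y <= t0], sharper as [k]
    grows. *)
Definition sigmoid (y : R) : R := (1 + expR (k * (y - t0)))^-1.

Lemma sigmoid_gt0 y : 0 < sigmoid y.
Proof. by rewrite invr_gt0 addr_gt0// expR_gt0. Qed.

Lemma sigmoid_lt1 y : sigmoid y < 1.
Proof. by rewrite invf_lt1 ?addr_gt0 ?expR_gt0// ltrDl expR_gt0. Qed.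

Lemma is_derive_sigmoid (y : R) : is_derive y 1 sigmoid (- k * (sigmoid y * (1 -
  sigmoid y))).
Proof.
have e0 : 1 + expR (k * (y - t0)) != 0 by rewrite gt_eqF// addr_gt0// expR_gt0.
have hl : is_derive y 1 (fun y : R => k * (y - t0)) k.
  by apply: is_derive_eq; rewrite /GRing.scale/=; ring.
have he : is_derive y 1 (fun y : R => 1 + expR (k * (y - t0))) (expR (k * (y - t0)) *
  k).
  have h1 : is_derive y 1 (fun y : R => expR (k * (y - t0))) (expR (k * (y - t0)) * k).
    exact: (@is_derive1_comp R expR _ y _ _ (is_derive_expR (k * (y - t0))) hl).
  rewrite -[X in is_derive _ _ _ X]add0r.
  exact: (is_deriveD (is_derive_cst (1 : R^o) y 1) h1).
apply: is_derive_eq; first exact: (is_deriveV _ he).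
rewrite /sigmoid; move: e0; move: (expR _) => e e0.
by rewrite /GRing.scale/=; field.
Qed.

Lemma measurable_sigmoid : measurable_fun setT sigmoid.
Proof.
apply: continuous_measurable_fun => y.
apply/differentiable_continuous/derivable1_diffP.
exact: (@ex_derive _ _ _ _ _ _ _ (is_derive_sigmoid y)).
Qed.

(* Polynomials in the sigmoids of the coordinates: as the derivative of a sigmoid is
   a polynomial in it, these are bounded together with all their derivatives. *)
Inductive sexpr := Cst of R | Sig of 'I_K | Add of sexpr & sexpr | Mul of sexpr & sexpr.

Fixpoint seval e x : R :=
  match e with
  | Cst c => c
  | Sig p => sigmoid (tcoord x p)
  | Add e1 e2 => seval e1 x + seval e2 x
  | Mul e1 e2 => seval e1 x * seval e2 x
  end.

Fixpoint sderiv a e : sexpr :=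
  match e with
  | Cst c => Cst 0
  | Sig p => Mul (Cst (- k * tcoord a p)) (Mul (Sig p) (Add (Cst 1) (Mul (Cst (- 1))
    (Sig p))))
  | Add e1 e2 => Add (sderiv a e1) (sderiv a e2)
  | Mul e1 e2 => Add (Mul (sderiv a e1) e2) (Mul e1 (sderiv a e2))
  end.

Lemma bounded_mfun_eval e : bounded_mfun (seval e).
Proof.
elim: e => [c|p|e1 h1 e2 h2|e1 h1 e2 h2] /=.
- exact: bounded_mfun_cst.
- split; first exact: (measurableT_comp measurable_sigmoid (measurable_tcoord p)).
  by exists 1 => x; rewrite gtr0_norm ?sigmoid_gt0// ltW// sigmoid_lt1.
- exact: bounded_mfunD.
- exact: bounded_mfunM.
Qed.

Lemma is_derive_eval e x a (y : R) :
  is_derive y 1 (fun z : R => seval e (tshift x z a)) (seval (sderiv a e) (tshift x y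
    a)).
Proof.
elim: e => [c|p|e1 h1 e2 h2|e1 h1 e2 h2] /=.
- exact: is_derive_cst.
- under eq_fun do rewrite tshiftE.
  have h : is_derive y 1 (fun z : R => tcoord x p + z * tcoord a p) (tcoord a p).
    by apply: is_derive_eq; rewrite /GRing.scale/=; ring.
  apply: is_derive_eq.
    exact: (@is_derive1_comp R sigmoid _ y _ _ (is_derive_sigmoid (tcoord x p + y *
      tcoord a p)) h).
  by rewrite tshiftE; ring.
- exact: is_deriveD.
- apply: is_derive_eq; rewrite /GRing.scale/=; ring.
Qed.

Lemma eval_taylor e a : exists C, forall x (z : R),
  `|seval e (tshift x z a) - (seval e x + seval (sderiv a e) x * z +
     seval (sderiv a (sderiv a e)) x / 2 * z ^+ 2)| <= C * `|z| ^+ 3.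
Proof.
have [_ [M hM]] := bounded_mfun_eval (sderiv a (sderiv a (sderiv a e))).
exists M => x z.
have x0 : tshift x 0 a = x by apply: tcoord_inj => i; rewrite tshiftE mul0r addr0.
rewrite -{2 3 4}x0.
apply: (taylor3 (is_derive_eval e x a) (is_derive_eval _ x a)
  (is_derive_eval _ x a)) => y; exact: hM.
Qed.

End SigmoidExpressions.

(** * Small-scale expansion of Gaussian averages and their generators *)

Section GaussianComparison.
Context {R : realType} {K : nat}.
Local Notation V := (K.-tuple (measurableTypeR R)).
Variables (k t0 : R).
Implicit Types (x a b : V) (p q : 'I_K) (A B : seq V) (e : @sexpr R K).
Local Notation seval := (seval k t0).
Local Notation sderiv := (sderiv k).
Local Notation v := (@gauss_var R).

(** Taylor along [a], with the first-order term killed by symmetry. The constant is uniform in [x]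
    because the third derivative is again a bounded expression. *)
Lemma gauss_avg_expand e a : exists2 C, 0 <= C & forall c x, 0 <= c ->
  `|gauss_avg (tscale c a) (seval e) x -
    (seval e x + c ^+ 2 * (v / 2 * seval (sderiv a (sderiv a e)) x))| <= C * c ^+ 3.
Proof.
have [C hC] := eval_taylor k t0 e a.
have C0 : 0 <= C.
  by have := le_trans (normr_ge0 _) (hC [tuple 0 | i < K] 1); rewrite normr1 expr1n
    mulr1.
exists (C * gauss_abs3) => [|c x c0]; first by rewrite mulr_ge0// gauss_abs3_ge0.
have -> : c ^+ 2 * (v / 2 * seval (sderiv a (sderiv a e)) x) =
    (seval (sderiv a (sderiv a e)) x / 2 * c ^+ 2) * v by ring.
have -> : C * gauss_abs3 * c ^+ 3 = (C * c ^+ 3) * gauss_abs3 by ring.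
apply: (@gauss_taylor _ _ _ (seval (sderiv a e) x * c)).
  exact/bounded_mfun_tshift/bounded_mfun_eval.
move=> z; have := hC x (z * c).
rewrite normrM (ger0_norm c0) !exprMn.
have -> : tshift x (z * c) a = tshift x z (tscale c a).
  by apply: tcoord_inj => i; rewrite !tshiftE tscaleE mulrA.
by rewrite -(mulrA C) (mulrC (c ^+ 3)) -(mulrA _ c) (mulrC c) -(mulrA _ (c ^+ 2))
  (mulrC (c ^+ 2)).
Qed.

(** The generator of the average over [A]: the coefficient of [c^2] when all directions are scaled
    by [c]. *)
Definition sgen A e x : R := \sum_(a <- A) v / 2 * seval (sderiv a (sderiv a e)) x.

Lemma bounded_mfun_gen A e : bounded_mfun (sgen A e).
Proof.
rewrite /sgen; elim: A => [|a A IH].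
  by under eq_fun do rewrite big_nil; exact: bounded_mfun_cst.
under eq_fun do rewrite big_cons.
by apply: bounded_mfunD => //; apply: bounded_mfunZ; exact: bounded_mfun_eval.
Qed.

Lemma normr_gauss_avgs A (f : V -> R) (M : R) : bounded_mfun f ->
  (forall x, `|f x| <= M) -> forall x, `|gauss_avgs A f x| <= M.
Proof.
move=> bf hM x; rewrite ler_norml.
have bc c : bounded_mfun (fun _ : V => c : R) by exact: bounded_mfun_cst.
apply/andP; split.
- have := @le_gauss_avgs _ _ A _ _ (bc (- M)) bf _ x.
  rewrite gauss_avgs_cst; apply => y.
  by have := hM y; rewrite ler_norml => /andP[].
- have := @le_gauss_avgs _ _ A _ _ bf (bc M) _ x.
  rewrite gauss_avgs_cst; apply => y.
  by have := hM y; rewrite ler_norml => /andP[].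
Qed.

(** Averaging along [a] gives [e + c^2 d] up to order [c^3], and [d] is again an expression, so the
    induction hypothesis applies to both [e] and [d]. What remains is of order [c^4] or [c^5],
    absorbed since [c <= 1]. *)
Lemma gauss_avgs_expand A e : exists2 C, 0 <= C & forall c x, 0 <= c -> c <= 1 ->
  `|gauss_avgs (map (tscale c) A) (seval e) x - (seval e x + c ^+ 2 * sgen A e x)|
  <= C * c ^+ 3.
Proof.
elim: A e => [|a A IH] e.
  exists 0 => // c x _ _.
  by rewrite /sgen big_nil /= mulr0 addr0 subrr normr0 mul0r.
pose d : @sexpr R K := Mul (Cst (v / 2)) (sderiv a (sderiv a e)).
have [C1 C10 h1] := gauss_avg_expand e a.
have [C2 C20 h2] := IH e.
have [C3 C30 h3] := IH d.
have [_ [M hM]] := bounded_mfun_gen A d.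
have M0 : 0 <= M := le_trans (normr_ge0 _) (hM [tuple 0 | i < K]).
exists (C1 + C2 + C3 + M) => [|c x c0 c1]; first by rewrite !addr_ge0.
have be := bounded_mfun_eval k t0 e.
have bd := bounded_mfun_eval k t0 d.
have ba := bounded_mfun_avg (tscale c a) be.
have bcd : bounded_mfun (fun x => c ^+ 2 * seval d x) := bounded_mfunZ _ bd.
have bed := bounded_mfunD be bcd.
pose r y := gauss_avg (tscale c a) (seval e) y - (seval e y + c ^+ 2 * seval d y).
have br : bounded_mfun r := bounded_mfunB ba bed.
have -> : gauss_avgs (map (tscale c) (a :: A)) (seval e) x =
  gauss_avgs (map (tscale c) A) r x + (gauss_avgs (map (tscale c) A) (seval e) x
  + c ^+ 2 * gauss_avgs (map (tscale c) A) (seval d) x).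
  rewrite /= (_ : gauss_avg _ _ = fun y => r y + (seval e y + c ^+ 2 * seval d y)).
    by rewrite (gauss_avgsD _ br bed) (gauss_avgsD _ be bcd) (gauss_avgsZ _ _ bd).
  by apply/funext => y; rewrite /r subrK.
have := h2 c x c0 c1; have := h3 c x c0 c1; have := hM x.
have : `|gauss_avgs (map (tscale c) A) r x| <= C1 * c ^+ 3.
  by apply: normr_gauss_avgs => // y; exact: h1.
have -> : sgen (a :: A) e x = seval d x + sgen A e x by rewrite /sgen big_cons.
move: (gauss_avgs _ r x) (gauss_avgs _ (seval e) x) (gauss_avgs _ (seval d) x) => G1
  G2 G3.
move: (seval e x) (seval d x) (sgen A e x) (sgen A d x) => E D L1 L2.
have c3 : 0 <= c ^+ 3 by exact: exprn_ge0.
have c2 : 0 <= c ^+ 2 by exact: exprn_ge0.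
have c43 : c ^+ 4 <= c ^+ 3 by rewrite exprSr ler_piMr.
have c53 : c ^+ 5 <= c ^+ 3 by rewrite (le_trans _ c43)// [leLHS]exprSr ler_piMr//
  exprn_ge0.
move=> g1 g2 g3 g4.
have -> : G1 + (G2 + c ^+ 2 * G3) - (E + c ^+ 2 * (D + L1)) =
  G1 + (G2 - (E + c ^+ 2 * L1)) + c ^+ 2 * (G3 - (D + c ^+ 2 * L2)) + c ^+ 4 * L2 by
    ring.
rewrite !mulrDl; apply: le_trans (ler_normD _ _) _; apply: lerD; last first.
  by rewrite normrM (ger0_norm (exprn_ge0 4 c0)) mulrC; apply: ler_pM => //; exact:
    exprn_ge0.
apply: le_trans (ler_normD _ _) _; apply: lerD; last first.
  rewrite normrM ger0_norm//; apply: le_trans (ler_wpM2l c2 g3) _.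
  by rewrite mulrCA -exprD ler_wpM2l.
by apply: le_trans (ler_normD _ _) _; apply: lerD.
Qed.

(** Comparing the generators at the single function [e] is enough: the averages are positive and
    commute, so the small-scale inequality survives all further averaging. *)
Lemma le_gauss_avgs_gen A B e : (forall x, sgen A e x <= sgen B e x) ->
  forall x, gauss_avgs A (seval e) x <= gauss_avgs B (seval e) x.
Proof.
move=> hAB.
have [C1 C10 h1] := gauss_avgs_expand A e.
have [C2 C20 h2] := gauss_avgs_expand B e.
apply: (@le_gauss_avgs_scale _ _ _ _ _ (C1 + C2)); first exact: bounded_mfun_eval.
move=> c x c0 c1; have := h1 c x c0 c1; have := h2 c x c0 c1.
rewrite !ler_norml mulrDl => /andP[g1 g2] /andP[g3 g4].
have := ler_wpM2l (exprn_ge0 2 c0) (hAB x); lra.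
Qed.

Definition unit_dir p : V := [tuple (i == p)%:R : R | i < K].

Lemma unit_dirE p q : tcoord (unit_dir p) q = (q == p)%:R.
Proof. by rewrite /tcoord tnth_mktuple. Qed.

Lemma eval_deriv_sum a e x :
  seval (sderiv a e) x = \sum_p tcoord a p * seval (sderiv (unit_dir p) e) x.
Proof.
elim: e => [c|p|e1 h1 e2 h2|e1 h1 e2 h2] /=.
- by rewrite big1// => p _; rewrite mulr0.
- rewrite (bigD1 p)//= big1 ?addr0 => [|q qp]; rewrite unit_dirE.
    by rewrite eqxx mulr1; ring.
  by rewrite eq_sym (negbTE qp) !(mulr0, mul0r).
- by rewrite h1 h2 -big_split; apply: eq_bigr => p _; rewrite mulrDr.
- rewrite h1 h2 mulr_suml mulr_sumr -big_split; apply: eq_bigr => p _ /=; ring.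
Qed.

(** Expands the inner direction. [sderiv b] acts on syntax and not on values, so [eval_deriv_sum]
    cannot be used beneath it and the induction is redone. *)
Lemma eval_deriv2_sum a b e x : seval (sderiv b (sderiv a e)) x =
  \sum_p tcoord a p * seval (sderiv b (sderiv (unit_dir p) e)) x.
Proof.
elim: e => [c|p|e1 h1 e2 h2|e1 h1 e2 h2] /=.
- by rewrite big1// => p _; rewrite mulr0.
- rewrite (bigD1 p)//= big1 ?addr0 => [|q qp]; rewrite unit_dirE.
    by rewrite eqxx !mulr1; ring.
  by rewrite eq_sym (negbTE qp) !(mulr0, mul0r, addr0).
- by rewrite h1 h2 -big_split; apply: eq_bigr => p _; rewrite mulrDr.
- rewrite h1 h2 !(eval_deriv_sum a) !mulr_suml !mulr_sumr -!big_split.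
  by apply: eq_bigr => p _ /=; ring.
Qed.

(** Here the individual directions disappear: the generator sees [A] only through its covariance
    matrix. *)
Lemma genE A e x : sgen A e x = v / 2 * \sum_p \sum_q
  (\sum_(a <- A) tcoord a p * tcoord a q)
  * seval (sderiv (unit_dir q) (sderiv (unit_dir p) e)) x.
Proof.
rewrite /sgen -mulr_sumr; congr (_ * _).
transitivity (\sum_(a <- A) \sum_p \sum_q tcoord a p * tcoord a q *
   seval (sderiv (unit_dir q) (sderiv (unit_dir p) e)) x).
  apply: eq_bigr => a _; rewrite eval_deriv2_sum; apply: eq_bigr => p _.
  rewrite eval_deriv_sum mulr_sumr; apply: eq_bigr => q _; exact: mulrA.
rewrite exchange_big; apply: eq_bigr => p _; rewrite exchange_big.
by apply: eq_bigr => q _; rewrite mulr_suml.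
Qed.

End GaussianComparison.

(** * The smooth min-max and the sign of its mixed derivatives *)

Section SoftMinMax.
Context {R : realType} {K : nat} {I : finType}.
Local Notation V := (K.-tuple (measurableTypeR R)).
Variables (k t0 : R) (r : 'I_K -> I).
Hypothesis k0 : 0 <= k.
Implicit Types (x a b : V) (p q : 'I_K) (A B : seq V) (e : @sexpr R K) (l : seq
  (@sexpr R K)).
Local Notation ev := (seval k t0).
Local Notation "''d_' p e" := (sderiv k (unit_dir p) e) (at level 10, p at level 2, e at level 9).

Definition sprod l : sexpr := foldr Mul (Cst 1) l.
Definition sone_minus e : sexpr := Add (Cst 1) (Mul (Cst (- 1)) e).
Definition srow (i : I) := sone_minus (sprod [seq Sig p | p <- enum 'I_K & r p == i]).
(* A smooth version of the indicator of
   [exists i, forall p, r p = i -> tcoord x p <= t0]. *)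
Definition softmm := sone_minus (sprod [seq srow i | i <- enum I]).

Lemma seval_sprod l x : ev (sprod l) x = \prod_(e <- l) ev e x.
Proof. by elim: l => [|e l IH] /=; rewrite ?big_nil ?big_cons// IH. Qed.

Lemma sprod_deriv_eq0 p l x : (forall e, List.In e l -> ev ('d_p e) x = 0) ->
  ev ('d_p (sprod l)) x = 0.
Proof.
elim: l => //= e l IH h.
rewrite h; last by left.
by rewrite IH ?mul0r ?mulr0 ?addr0// => e' h'; apply: h; right.
Qed.

Lemma sprod_deriv_le0 p l x :
  (forall e, List.In e l -> 0 <= ev e x /\ ev ('d_p e) x <= 0) ->
  0 <= ev (sprod l) x /\ ev ('d_p (sprod l)) x <= 0.
Proof.
elim: l => [|e l IH] h /=; first by rewrite ler01.
have [e0 e1] := h e (or_introl erefl).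
have [l0 l1] := IH (fun e' h' => h e' (or_intror h')).
by split; nra.
Qed.

Lemma sprod_deriv2_eq0 p q l x :
  (forall e, List.In e l -> ev ('d_p e) x = 0) \/
  (forall e, List.In e l -> ev ('d_q e) x = 0) ->
  (forall e, List.In e l -> ev ('d_q ('d_p e)) x = 0) ->
  ev ('d_q ('d_p (sprod l))) x = 0.
Proof.
elim: l => [//|e l IH].
move=> hpq h2 /=.
rewrite h2; last by left.
rewrite IH; last 2 first.
- by case: hpq => h; [left|right] => e' h'; apply: h; right.
- by move=> e' h'; apply: h2; right.
case: hpq => h; rewrite (h e (or_introl erefl)).
- rewrite (@sprod_deriv_eq0 p) ?(mulr0, mul0r, addr0)//.
  by move=> e' h'; apply: h; right.
- rewrite (@sprod_deriv_eq0 q) ?(mulr0, mul0r, addr0)//.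
  by move=> e' h'; apply: h; right.
Qed.

Lemma sprod_deriv2_ge0 p q l x :
  (forall e, List.In e l -> [/\ 0 <= ev e x, 0 <= ev ('d_p e) x,
     0 <= ev ('d_q e) x & 0 <= ev ('d_q ('d_p e)) x]) ->
  [/\ 0 <= ev (sprod l) x, 0 <= ev ('d_p (sprod l)) x,
     0 <= ev ('d_q (sprod l)) x & 0 <= ev ('d_q ('d_p (sprod l))) x].
Proof.
elim: l => [|e l IH] h.
  by rewrite /= ler01 lexx.
have [e0 e1 e2 e3] := h e (or_introl erefl).
have [l0 l1 l2 l3] := IH (fun e' h' => h e' (or_intror h')).
by split; rewrite /= ?addr_ge0// ?mulr_ge0.
Qed.

Lemma sig_deriv p q x : ev ('d_p (Sig q)) x =
  - k * (q == p)%:R * (sigmoid k t0 (tcoord x q) * (1 - sigmoid k t0 (tcoord x q))).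
Proof. by rewrite /= unit_dirE mulN1r. Qed.

Lemma sig_deriv_le0 p q x : ev ('d_p (Sig q)) x <= 0.
Proof.
rewrite sig_deriv !mulNr oppr_le0.
have := sigmoid_gt0 k t0 (tcoord x q); have := sigmoid_lt1 k t0 (tcoord x q).
by move=> s1 s0; rewrite !mulr_ge0// ?subr_ge0 ltW.
Qed.

Lemma in_row e i : List.In e [seq Sig p | p <- enum 'I_K & r p == i] ->
  exists2 p, e = @Sig R K p & r p = i.
Proof.
elim: (enum 'I_K) => //= p s IH; case: ifPn => [/eqP rp|_]; last exact: IH.
by case=> [<-|]; [exists p|exact: IH].
Qed.

Lemma in_rows e : List.In e [seq srow i | i <- enum I] -> exists i, e = srow i.
Proof. by elim: (enum I) => //= i s IH; case=> [<-|//]; exists i. Qed.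

Lemma sig_deriv_eq0 p q x : q != p -> ev ('d_p (Sig q)) x = 0.
Proof. by move=> qp; rewrite sig_deriv (negbTE qp) mulr0 mul0r. Qed.

Lemma sig_deriv2_eq0 p q s x : s != p \/ s != q -> ev ('d_q ('d_p (Sig s))) x = 0.
Proof.
rewrite /= !unit_dirE => -[/negbTE->|/negbTE->];
by rewrite !(mulr0, mul0r, addr0).
Qed.

(** Sigmoids decrease, so one minus their product increases in each coordinate. As [p] and [q] lie
    in different rows, one of them is absent from row [i], which makes the mixed derivative
    vanish. *)
Lemma srow_deriv p q i x : r p != r q -> [/\ 0 <= ev (srow i) x,
  0 <= ev ('d_p (srow i)) x, 0 <= ev ('d_q (srow i)) x
  & 0 <= ev ('d_q ('d_p (srow i))) x].
Proof.
move=> pq; rewrite /srow.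
set l : seq (@sexpr R K) := map _ _.
have hl s e : List.In e l -> 0 <= ev e x /\ ev ('d_s e) x <= 0.
  move=> /in_row[s' -> _]; split; last exact: sig_deriv_le0.
  by rewrite ltW// sigmoid_gt0.
have [l0 lp] := sprod_deriv_le0 (hl p).
have [_ lq] := sprod_deriv_le0 (hl q).
have lpq : ev ('d_q ('d_p (sprod l))) x = 0.
  apply: sprod_deriv2_eq0.
    have [rp|rp] := eqVneq (r p) i.
      right=> e /in_row[s -> rs]; apply: sig_deriv_eq0.
      by apply: contraNneq pq => sq; rewrite rp -rs sq.
    left=> e /in_row[s -> rs]; apply: sig_deriv_eq0.
    by apply: contraNneq rp => <-; exact/eqP.
  move=> e /in_row[s -> rs]; apply: sig_deriv2_eq0.
  have [rp|rp] := eqVneq (r p) i.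
    by right; apply: contraNneq pq => sq; rewrite rp -rs sq.
  by left; apply: contraNneq rp => <-; exact/eqP.
have l1 : ev (sprod l) x <= 1.
  rewrite seval_sprod big_map; apply: prodr_ile1 => s _ /=.
  by rewrite !ltW ?sigmoid_gt0 ?sigmoid_lt1.
by split; rewrite /= ?lpq; lra.
Qed.

(** By Leibniz, a product of factors with nonnegative values, first derivatives and mixed
    derivatives has a nonnegative mixed derivative; [softmm] is one minus such a product. *)
Lemma softmm_deriv2_le0 p q x : r p != r q -> ev ('d_q ('d_p softmm)) x <= 0.
Proof.
move=> pq; have [_ _ _ h] : [/\ 0 <= ev (sprod [seq srow i | i <- enum I]) x,
   0 <= ev ('d_p (sprod [seq srow i | i <- enum I])) x,
   0 <= ev ('d_q (sprod [seq srow i | i <- enum I])) x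
   & 0 <= ev ('d_q ('d_p (sprod [seq srow i | i <- enum I]))) x].
  by apply: sprod_deriv2_ge0 => e /in_rows[i ->]; exact: srow_deriv.
rewrite /=; lra.
Qed.

(* Gordon's comparison, the covariances being those of the processes
   [\sum_a z_a a] over the two lists of directions. *)
Lemma gordon_softmm A B :
  (forall p q, r p = r q ->
    \sum_(a <- A) tcoord a p * tcoord a q = \sum_(a <- B) tcoord a p * tcoord a q) ->
  (forall p q, r p != r q ->
    \sum_(a <- B) tcoord a p * tcoord a q <= \sum_(a <- A) tcoord a p * tcoord a q) ->
  forall x, gauss_avgs A (ev softmm) x <= gauss_avgs B (ev softmm) x.
Proof.
move=> heq hle; apply: le_gauss_avgs_gen => x; rewrite !genE.
apply: ler_wpM2l; first by rewrite divr_ge0// gauss_var_ge0.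
apply: ler_sum => p _; apply: ler_sum => q _.
have [rpq|rpq] := eqVneq (r p) (r q); first by rewrite heq.
by apply: ler_wnM2r; [exact: softmm_deriv2_le0|exact: hle].
Qed.

Local Notation sig := (sigmoid k t0).

Lemma seval_softmm x :
  ev softmm x = 1 - \prod_i (1 - \prod_(p | r p == i) sig (tcoord x p)).
Proof.
rewrite /= mulN1r seval_sprod big_map big_enum; congr (1 - _).
apply: eq_bigr => i _.
by rewrite /= mulN1r seval_sprod big_map big_filter big_enum_cond.
Qed.

Lemma prod_sig_itv x (P : pred 'I_K) : 0 <= \prod_(p | P p) sig (tcoord x p) <= 1.
Proof.
rewrite prodr_ge0 ?prodr_ile1// => p _; last by rewrite ltW ?sigmoid_gt0.
by rewrite !ltW ?sigmoid_gt0 ?sigmoid_lt1.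
Qed.

Lemma softmm_itv x : 0 <= ev softmm x <= 1.
Proof.
rewrite seval_softmm subr_ge0 lerBlDr lerDl prodr_ge0 ?prodr_ile1// => i _;
by have /andP[? ?] := prod_sig_itv x (fun p => r p == i); lra.
Qed.

Lemma le_softmm x y : (forall p, tcoord x p <= tcoord y p) -> ev softmm y <= ev
  softmm x.
Proof.
move=> xy; rewrite !seval_softmm lerB// ler_prod// => i _.
have /andP[h1 h2] := prod_sig_itv x (fun p => r p == i).
rewrite subr_ge0 h2/= lerB// ler_prod// => p _.
rewrite ltW ?sigmoid_gt0//= lef_pV2 ?posrE ?addr_gt0 ?expR_gt0//.
by rewrite lerD2l ler_expR ler_wpM2l// lerB.
Qed.

(** Bernoulli's inequality for unequal factors, proved by adding one factor at a time; the indices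
    outside [P] count as factors 1. *)
Lemma prod_ge_1B (J : finType) (P : pred J) (F : J -> R) (eta : R) : 0 <= eta ->
  (forall j, P j -> 0 <= F j <= 1) -> (forall j, P j -> 1 - eta <= F j) ->
  1 - #|J|%:R * eta <= \prod_(j | P j) F j.
Proof.
move=> eta0 F01 hF.
rewrite big_mkcond /= -big_enum /= cardE.
elim: (enum J) => [|j s IH]; first by rewrite big_nil /= mul0r subr0.
rewrite big_cons /= -natr1 mulrDl mul1r.
have : 0 <= \prod_(j <- s) (if P j then F j else 1) <= 1.
  have H01 i : 0 <= (if P i then F i else 1) <= 1.
    by case: ifPn => [/F01//|_]; rewrite ler01 lexx.
  by rewrite prodr_ge0 ?prodr_ile1// => i _; have /andP[] := H01 i.
move: IH; set Q := \prod_(_ <- _) _ => IH /andP[Q0 Q1].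
have : 1 - eta <= (if P j then F j else 1) <= 1.
  case: ifPn => [Pj|_]; last by rewrite lexx andbT gerBl.
  by rewrite hF//=; have /andP[] := F01 _ Pj.
by move: (if _ then _ else _) => f /andP[f0 f1]; nra.
Qed.

(** One row below the threshold is enough, since the functional is at least the product of the
    sigmoids of that row. The margin [dl] brings each of them within [expR (- (k * dl))] of 1. *)
Lemma softmm_ge x (dl : R) (i : I) : 
  (forall p, r p = i -> tcoord x p <= t0 - dl) ->
  1 - K%:R * expR (- (k * dl)) <= ev softmm x.
Proof.
move=> h; rewrite seval_softmm.
have h1 : 1 - K%:R * expR (- (k * dl)) <= \prod_(p | r p == i) sig (tcoord x p).
  rewrite -[K in K%:R]card_ord; apply: prod_ge_1B => [|p _|]; first exact: expR_ge0.
    by rewrite !ltW ?sigmoid_gt0 ?sigmoid_lt1.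
  move=> p /eqP /h xp.
  apply: (@le_trans _ _ (1 - expR (k * (tcoord x p - t0)))).
    by rewrite lerB// ler_expR -mulrN ler_wpM2l//; lra.
  rewrite /sigmoid; have := expR_gt0 (k * (tcoord x p - t0)).
  move: (expR _) => e e0; rewrite -[leRHS]mul1r ler_pdivlMr; nra.
apply: (le_trans h1); rewrite lerBrDr addrC -lerBrDr (bigD1 i)//= ler_piMr//.
  by rewrite subr_ge0; have /andP[] := prod_sig_itv x (fun p => r p == i).
rewrite prodr_ile1// => j _.
by have /andP[? ?] := prod_sig_itv x (fun p => r p == j); lra.
Qed.

Lemma softmm_le x (dl : R) :
  (forall i, exists2 p, r p = i & t0 + dl <= tcoord x p) ->
  ev softmm x <= #|I|%:R * expR (- (k * dl)).
Proof.
move=> h; rewrite seval_softmm lerBlDr addrC -lerBlDr.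
apply: prod_ge_1B; first exact: expR_ge0.
- move=> i _; have /andP[? ?] := prod_sig_itv x (fun p => r p == i); lra.
move=> i _; rewrite lerB//; have [p /eqP rp xp] := h i.
rewrite (bigD1 p)//=.
have /andP[g0 g1] := prod_sig_itv x (fun q => (r q == i) && (q != p)).
apply: (@le_trans _ _ (sig (tcoord x p))).
  by rewrite ler_piMr// ltW// sigmoid_gt0.
apply: (@le_trans _ _ (expR (- (k * (tcoord x p - t0))))); last first.
  by rewrite ler_expR lerN2 ler_wpM2l//; lra.
rewrite expRN /sigmoid lef_pV2 ?posrE ?addr_gt0 ?expR_gt0//; lra.
Qed.

End SoftMinMax.

(** * Monotone functionals and the cost of an added Gaussian *)

Section HalfSpace.
Context {R : realType} {K : nat}.
Local Notation V := (K.-tuple (measurableTypeR R)).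
Implicit Types (x a : V) (f : V -> R).

Definition nonincr f := forall x y, (forall p, tcoord x p <= tcoord y p) -> f y <= f x.

Lemma nonincr_gauss_avg f a : bounded_mfun f -> nonincr f -> nonincr (gauss_avg a f).
Proof.
move=> bf nf x y xy; apply: le_Rexp; try exact: bounded_mfun_tshift.
by move=> z; apply: nf => p; rewrite !tshiftE lerD2r.
Qed.

Lemma gauss_avg_ge0 f a : (forall x, 0 <= f x) -> forall x, 0 <= gauss_avg a f x.
Proof. by move=> f0 x; apply: Rintegral_ge0. Qed.

(* Of the two points x + z a and x - z a one lies below x. *)
Lemma gauss_avg_ge_half f a x : bounded_mfun f -> (forall x, 0 <= f x) -> nonincr f ->
  (forall p, 0 <= tcoord a p) -> f x / 2 <= gauss_avg a f x.
Proof.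
move=> bf f0 nf a0.
have b1 := bounded_mfun_tshift x a bf.
have b2 := bounded_mfun_gaussN b1.
suff : f x <= gauss_avg a f x + gauss_avg a f x by lra.
rewrite {2}/gauss_avg -(Rexp_gaussN b1) -RexpD//.
rewrite -[leLHS](Rexp_cst gauss); apply: le_Rexp.
- exact: bounded_mfun_cst.
- exact: bounded_mfunD.
move=> z; have [z0|z0] := leP 0 (z : R).
- rewrite -[leLHS]add0r lerD// nf// => p.
  by rewrite tshiftE mulNr lerBlDr lerDl mulr_ge0.
- rewrite -[leLHS]addr0 lerD// nf// => p.
  by rewrite tshiftE gerDl mulr_le0_ge0// ltW.
Qed.

End HalfSpace.

(** * Comparison of finitely many random variables *)

Section IndependentShift.
Context {d} {Omega : measurableType d} {R : realType} {K : nat}.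
Local Notation V := (K.-tuple (measurableTypeR R)).
Variable P : probability Omega R.

(** The law of [(W, xi)] agrees with a product measure on rectangles, hence everywhere, and Fubini
    integrates [xi] out first. *)
Lemma Rexp_independent_shift (W : Omega -> V) (xi : Omega -> measurableTypeR R)
    (a : V) (f : V -> R) :
  measurable_fun setT W -> measurable_fun setT xi ->
  (forall A B, measurable A -> measurable B ->
    P (W @^-1` A `&` xi @^-1` B) = (P (W @^-1` A) * gauss B)%E) ->
  bounded_mfun f ->
  \int[P]_w f (tshift (W w) (xi w) a) = \int[P]_w gauss_avg a f (W w).
Proof.
move=> mW mxi ind bf.
pose X : {mfun Omega >-> V} := HB.pack W (isMeasurableFun.Build _ _ _ _ _ mW).
pose PW : probability V R := distribution P X.
have mWx : measurable_fun setT (fun w => (W w, xi w)) by exact: measurable_fun_pair.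
pose F (xz : V * measurableTypeR R) := f (tshift xz.1 xz.2 a).
have bF : bounded_mfun F := bounded_mfun_comp (measurable_tshift a) bf.
have ba := bounded_mfun_avg a bf.
have prodE A : measurable A -> (PW \x gauss)%E A = image_measure P mWx A.
  move=> mA; apply: (product_measure_unique (m' := image_measure P mWx) _ mA) => B C
    mB mC.
  exact: ind.
transitivity (\int[image_measure P mWx]_z F z).
  rewrite /Rintegral; congr fine; apply/esym.
  apply: (@integral_pushforward _ _ _ _ _ _ mWx P setT (EFin \o F)) => //.
  - by apply/measurable_EFinP; case: bF.
  - exact/bounded_mfun_integrable/(bounded_mfun_comp mWx bF).
transitivity (\int[(PW \x gauss)%E]_z F z).
  rewrite /Rintegral; congr fine; apply: eq_measure_integral => A mA _.
  exact/esym/prodE.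
rewrite -Rexp_prod// /Rintegral; congr fine.
rewrite -[RHS](@integral_distribution _ _ _ _ _ P X (EFin \o gauss_avg a f))//.
- by apply/measurable_EFinP; case: ba.
- exact/bounded_mfun_integrable/(bounded_mfun_comp mW ba).
Qed.

End IndependentShift.

(** * Integrating out independent Gaussians one at a time *)

Section GaussianSum.
Context {d} {Omega : measurableType d} {R : realType} {K : nat} {J : finType}.
Local Notation V := (K.-tuple (measurableTypeR R)).
Variable P : probability Omega R.
Variables (G0 : set (set Omega)) (W0 : Omega -> V) (xi : J -> Omega -> R) (c : J -> V).
Hypothesis G0m : <<s G0 >> `<=` measurable.
Hypothesis W0m : forall p (B : set R), measurable B ->
  <<s G0 >> ((fun w => tcoord (W0 w) p) @^-1` B).
Hypothesis xi_gauss : iid_std_gaussian P xi.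
Hypothesis xi_ind : forall A B, <<s G0 >> A -> sigma_gen setT xi B ->
  P (A `&` B) = (P A * P B)%E.

Definition gaussian_sum (s : seq J) (w : Omega) : V :=
  [tuple tcoord (W0 w) p + \sum_(j <- s) xi j w * tcoord (c j) p | p < K].

Lemma gaussian_sum_cons j s w :
  gaussian_sum (j :: s) w = tshift (gaussian_sum s w) (xi j w) (c j).
Proof.
apply: tcoord_inj => p; rewrite tshiftE /gaussian_sum /tcoord !tnth_mktuple big_cons.
by rewrite addrAC addrA.
Qed.

(** A pi-system for the information in [G0] and in the variables [xi j], [j] in [D]. It records
    which Gaussians have been used, so that the next one is independent of it. *)
Definition cylinders (D : {set J}) : set (set Omega) :=
  [set E | exists A (B : J -> set R), [/\ <<s G0 >> A, forall j, measurable (B j)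
    & E = A `&` \bigcap_(j in [set` D]) (xi j @^-1` B j)]].

Let mxi j : measurable_fun setT (xi j). Proof. by case: xi_gauss. Qed.

Let mpre j B : measurable B -> measurable (xi j @^-1` B).
Proof. by move=> mB; rewrite -[X in measurable X]setTI; exact: mxi. Qed.

Lemma setI_closed_cylinders D : setI_closed (cylinders D).
Proof.
move=> _ _ [A [B [mA mB ->]]] [A' [B' [mA' mB' ->]]].
exists (A `&` A'), (fun j => B j `&` B' j); split.
- exact: (@measurableI _ (g_sigma_algebraType G0)).
- by move=> j; exact: measurableI.
- rewrite setIACA -bigcapI; congr (_ `&` _).
Qed.

Lemma sigma_gen_bigcap (D : {set J}) (B : J -> set R) : (forall j, measurable (B j)) ->
  sigma_gen setT xi (\bigcap_(j in [set` D]) (xi j @^-1` B j)).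
Proof.
move=> mB.
apply: (@fin_bigcap_measurable _ (g_sigma_algebraType _)) => // j _.
apply: sub_sigma_algebra; exists j => //; exists (B j) => //; by rewrite setTI.
Qed.

Lemma cylinders_measurable D : cylinders D `<=` measurable.
Proof.
move=> _ [A [B' [mA mB' ->]]]; apply: measurableI; first exact: G0m.
by apply: fin_bigcap_measurable => // j _; exact: mpre.
Qed.

(** For fixed [B], both sides are finite measures in [E]; they agree on the pi-system of cylinders,
    hence on the sigma-algebra it generates. *)
Lemma cylinders_independent (D : {set J}) l B E : l \notin D -> measurable B ->
  <<s cylinders D >> E -> P (E `&` xi l @^-1` B) = (gauss B * P E)%E.
Proof.
move=> lD mB.
have mcyl := @cylinders_measurable D.
have gB : gauss B \is a fin_num by exact: fin_num_measure.
have gB0 : 0 <= fine (gauss B) by exact: fine_ge0.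
pose m1 := mrestr P (mpre l mB).
pose m2 := mscale (NngNum gB0) P.
have H : forall E, cylinders D E -> m1 E = m2 E.
  move=> _ [A [B' [mA mB' ->]]].
  rewrite /m1 /m2 /mrestr /mscale /= fineK//.
  (* The condition on [xi l] is merged into the family indexed by [D], so that mutual independence
     over [l |: D] splits off its factor. *)
  pose B'' j := if j == l then B else B' j.
  have mB'' j : measurable (B'' j) by rewrite /B''; case: ifP.
  have E1 : \bigcap_(j in [set` D]) (xi j @^-1` B' j) `&` xi l @^-1` B =
      \bigcap_(j in [set` (l |: D)%SET]) (xi j @^-1` B'' j).
    apply/seteqP; split => w /=.
      move=> [h1 h2] j /=; rewrite in_setU1 /B'' => /orP[/eqP->|jD].
        by rewrite eqxx.
      by case: eqP => [->//|_]; exact: h1.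
    move=> h; split => [j /= jD|].
      have := h j; rewrite /= in_setU1 jD orbT /B'' => /(_ isT).
      by case: eqP => // jl; move: lD; rewrite -jl jD.
    by have := h l; rewrite /= in_setU1 eqxx /B'' eqxx; apply.
  have [_ xl ind] := xi_gauss.
  rewrite -setIA E1 !xi_ind//; try exact: sigma_gen_bigcap.
  rewrite !ind// big_setU1//= /B'' eqxx xl// muleCA; congr (_ * (_ * _))%E.
  by apply: eq_bigr => j jD; case: eqP => // jl; move: lD; rewrite -jl jD.
move=> hE.
transitivity (m2 E); last by rewrite /m2 /mscale /= fineK.
apply: (@g_sigma_algebra_measure_unique _ R Omega (cylinders D) mcyl (fun=> setT) _ _
  m1 m2) => //.
- move=> _; exists setT, (fun=> setT); split => //.
    exact: (@measurableT _ (g_sigma_algebraType G0)).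
  by rewrite setTI; apply/esym; rewrite -subTset => w _ j _.
- by rewrite bigcup_const//; exists 0%N.
- exact: setI_closed_cylinders.
- move=> _; rewrite /m1 /= /mrestr setTI.
  by rewrite (le_lt_trans (probability_le1 _ _)) ?ltry//; exact: mpre.
Qed.

Lemma measurable_gaussian_sum (D : {set J}) s A : (forall j, j \in s -> j \in D) ->
  measurable A -> <<s cylinders D >> (gaussian_sum s @^-1` A).
Proof.
move=> sD mA.
pose T := g_sigma_algebraType (cylinders D).
have m0 p : measurable_fun setT (fun w : T => tcoord (W0 w) p : measurableTypeR R).
  move=> _ B mB; rewrite setTI; apply: sub_sigma_algebra.
  exists ((fun w => tcoord (W0 w) p) @^-1` B), (fun=> setT); split => //.
    exact: W0m.
  by apply/esym/setIidPl => w _ j _.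
have mx j : j \in s -> measurable_fun setT (xi j : T -> measurableTypeR R).
  move=> js _ B mB; rewrite setTI; apply: sub_sigma_algebra.
  exists setT, (fun i => if i == j then B else setT); split => //.
  - exact: (@measurableT _ (g_sigma_algebraType G0)).
  - by move=> i; case: ifP.
  - rewrite setTI; apply/seteqP; split => w /=.
      by move=> h i _ /=; case: eqP => [->|].
    by move=> /(_ j (sD j js)) /=; rewrite eqxx.
have mS p : measurable_fun setT
    (fun w : T => \sum_(j <- s) xi j w * tcoord (c j) p : measurableTypeR R).
  elim: s mx {sD} => [|j s IH] mx.
    apply: (eq_measurable_fun (fun _ : T => 0 : measurableTypeR R)) => [w _|].
      by rewrite big_nil.
    exact: measurable_cst.
  apply: (eq_measurable_fun (fun w : T => xi j w * tcoord (c j) p +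
      \sum_(i <- s) xi i w * tcoord (c i) p : measurableTypeR R)) => [w _|].
    by rewrite big_cons.
  apply: measurable_funD.
    by apply: measurable_funM => //; apply: mx; rewrite mem_head.
  by apply: IH => i si; apply: mx; rewrite inE si orbT.
have : measurable_fun setT (gaussian_sum s : T -> V).
  apply: measurable_tuple => p.
  apply: (eq_measurable_fun (fun w : T => tcoord (W0 w) p +
      \sum_(i <- s) xi i w * tcoord (c i) p : measurableTypeR R)) => [w _|].
    by rewrite /tcoord tnth_mktuple.
  exact: (measurable_funD (m0 p) (mS p)).
by move=> /(_ measurableT A mA); rewrite setTI.
Qed.

Lemma measurable_gaussian_sumT s : measurable_fun setT (gaussian_sum s).
Proof.
move=> _ A mA; rewrite setTI.
have : <<s cylinders [set i in s] >> (gaussian_sum s @^-1` A).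
  by apply: measurable_gaussian_sum => // i; rewrite inE.
apply: smallest_sub; first exact: sigma_algebra_measurable.
exact: cylinders_measurable.
Qed.


(** [uniq s] keeps the head [j] out of the tail, so [xi j] is independent of the partial sum over
    the tail and turns into a [gauss_avg] along [c j]. *)
Lemma Rexp_gaussian_sum s f : uniq s -> bounded_mfun f ->
  \int[P]_w f (gaussian_sum s w) = \int[P]_w gauss_avgs [seq c j | j <- s] f (W0 w).
Proof.
elim: s f => [|j s IH] f /=.
  move=> _ bf; apply: eq_Rintegral => w _; congr f.
  by apply: tcoord_inj => p; rewrite /tcoord tnth_mktuple big_nil addr0.
move=> /andP[js us] bf.
transitivity (\int[P]_w f (tshift (gaussian_sum s w) (xi j w) (c j))).
  by apply: eq_Rintegral => w _; rewrite gaussian_sum_cons.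
transitivity (\int[P]_w gauss_avg (c j) f (gaussian_sum s w)); last first.
  by apply: IH => //; exact: bounded_mfun_avg.
apply: Rexp_independent_shift => //; [exact: measurable_gaussian_sumT|exact: mxi|].
move=> A B mA mB; rewrite muleC.
apply: (@cylinders_independent [set i in s]) => //; first by rewrite inE.
by apply: measurable_gaussian_sum => // i; rewrite inE.
Qed.

End GaussianSum.

(** * The comparison of probabilities for finitely many points *)

Section FiniteComparison.
Context {d} {Omega : measurableType d} {R : realType} {K : nat} {I J : finType}.
Local Notation V := (K.-tuple (measurableTypeR R)).
Variable P : probability Omega R.
Variables (G0 : set (set Omega)) (W0 : Omega -> V) (xi : J -> Omega -> R).
Hypothesis G0m : <<s G0 >> `<=` measurable.
Hypothesis W0m : forall p (B : set R), measurable B ->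
  <<s G0 >> ((fun w => tcoord (W0 w) p) @^-1` B).
Hypothesis xi_gauss : iid_std_gaussian P xi.
Hypothesis xi_ind : forall A B, <<s G0 >> A -> sigma_gen setT xi B ->
  P (A `&` B) = (P A * P B)%E.
Variables (r : 'I_K -> I) (cY cZ : J -> V) (c1 c2 : V).
Hypotheses (c1_ge0 : forall p, 0 <= tcoord c1 p) (c2_ge0 : forall p, 0 <= tcoord c2 p).

Let covY p q := tcoord c1 p * tcoord c1 q + tcoord c2 p * tcoord c2 q
  + \sum_j tcoord (cY j) p * tcoord (cY j) q.
Let covZ p q := \sum_j tcoord (cZ j) p * tcoord (cZ j) q.
Hypothesis cov_eq : forall p q, r p = r q -> covY p q = covZ p q.
Hypothesis cov_le : forall p q, r p != r q -> covZ p q <= covY p q.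

Local Notation Y := (gaussian_sum W0 xi cY (enum J)).
Local Notation Z := (gaussian_sum W0 xi cZ (enum J)).

Lemma measurable_exists_row (X : Omega -> V) (Q : R -> bool) :
  measurable_fun setT X -> measurable [set y | Q y] ->
  measurable [set w | exists i, forall p, r p = i -> Q (tcoord (X w) p)].
Proof.
move=> mX mQ.
rewrite (_ : [set w | _] = \bigcup_(i in [set: I]) \bigcap_(p in [set p | r p = i])
   ((fun w => tcoord (X w) p) @^-1` [set y | Q y])); last first.
  apply/seteqP; split => w /= [i]; first by move=> h; exists i.
  by move=> _ h; exists i.
apply: fin_bigcup_measurable => // i _; apply: fin_bigcap_measurable => // p _.
rewrite -[X in measurable X]setTI.
exact: (measurableT_comp (measurable_tcoord p) mX).
Qed.

Lemma Rexp_indic (E : set Omega) : measurable E -> \int[P]_w \1_E w = fine (P E).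
Proof. by move=> mE; rewrite /Rintegral integral_indic// setIT. Qed.

Lemma bounded_mfun_indic (E : set Omega) : measurable E -> bounded_mfun (\1_E : Omega
  -> R).
Proof.
move=> mE; split; first exact: measurable_indic.
by exists 1 => w; rewrite indicE; case: (_ \in _); rewrite ?normr1 ?normr0.
Qed.

Let mY : measurable_fun setT Y. Proof. exact: (measurable_gaussian_sumT _ G0m W0m
  xi_gauss). Qed.
Let mZ : measurable_fun setT Z. Proof. exact: (measurable_gaussian_sumT _ G0m W0m
  xi_gauss). Qed.

Lemma comparison_softmm (k t0 : R) : 0 <= k ->
  \int[P]_w seval k t0 (softmm r) (Y w) <= 4 * \int[P]_w seval k t0 (softmm r) (Z w).
Proof.
move=> k0; set f := seval k t0 (softmm r).
have bf : bounded_mfun f := bounded_mfun_eval k t0 _.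
have f0 x : 0 <= f x by have /andP[] := softmm_itv k t0 r x.
have nf : nonincr f by move=> x y; exact: le_softmm.
have b1 := bounded_mfun_avg c1 bf.
have b2 := bounded_mfun_avg c2 b1.
have f1 := gauss_avg_ge0 c1 f0.
have n1 := nonincr_gauss_avg c1 bf nf.
have mW0 : measurable_fun setT W0.
  by apply: measurable_tuple => p _ B mB; rewrite setTI; apply: G0m; exact: W0m.
rewrite (Rexp_gaussian_sum cY G0m W0m xi_gauss xi_ind (enum_uniq _) bf)
  (Rexp_gaussian_sum cZ G0m W0m xi_gauss xi_ind (enum_uniq _) bf).
rewrite -RexpZ; last exact: (bounded_mfun_comp mW0 (bounded_mfun_avgs _ bf)).
apply: le_Rexp.
- exact: (bounded_mfun_comp mW0 (bounded_mfun_avgs _ bf)).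
- apply: bounded_mfunZ.
  exact: (bounded_mfun_comp mW0 (bounded_mfun_avgs _ bf)).
move=> w; move: (W0 w) => x.
set AY := [seq cY j | j <- enum J]; set AZ := [seq cZ j | j <- enum J].
(* The two added Gaussians appear only as the directions [c1] and [c2], averaged innermost; each
   costs a factor 2. *)
apply: (@le_trans _ _ (4 * gauss_avgs [:: c1, c2 & AY] f x)).
  rewrite /= -[leRHS]/((fun x => 4 * gauss_avgs AY _ x) x) -gauss_avgsZ//.
  apply: le_gauss_avgs => //; first exact: bounded_mfunZ.
  move=> y.
  have h1 := gauss_avg_ge_half y bf f0 nf c1_ge0.
  have h2 := gauss_avg_ge_half y b1 f1 n1 c2_ge0.
  lra.
rewrite ler_pM2l//; apply: gordon_softmm => // p q rpq.
- by have := cov_eq rpq; rewrite /covY /covZ !big_cons /AY /AZ (big_map cY) (big_map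
  cZ) !big_enum addrA.
- by have := cov_le rpq; rewrite /covY /covZ !big_cons /AY /AZ (big_map cY) (big_map
  cZ) !big_enum addrA.
Qed.

(** The gap from [t1] to [t2] leaves room for the soft threshold: with [t0] at the midpoint, both
    events keep a margin [dl], half the gap. *)
Lemma finite_comparison (t1 t2 : R) : t1 < t2 ->
  (P [set w | exists i, forall p, r p = i -> (tcoord (Y w) p <= t1)%R] <=
   4%:E * P [set w | exists i, forall p, r p = i -> (tcoord (Z w) p < t2)%R])%E.
Proof.
move=> t12.
set EY := [set w | _]; set EZ := [set w | _].
have mEY : measurable EY.
  apply: (@measurable_exists_row _ (fun y => y <= t1)) => //.
  rewrite -set_itvNyc; exact: measurable_itv.
have mEZ : measurable EZ.
  apply: (@measurable_exists_row _ (fun y => y < t2)) => //.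
  rewrite -set_itvNyo; exact: measurable_itv.
have bY := bounded_mfun_indic mEY; have bZ := bounded_mfun_indic mEZ.
rewrite -(fineK (fin_num_measure P _ mEY)) -(fineK (fin_num_measure P _ mEZ)).
rewrite -EFinM lee_fin.
have PY1 : fine (P EY) <= 1.
  by rewrite -lee_fin fineK ?fin_num_measure//; exact: probability_le1.
pose t0 := (t1 + t2) / 2; pose dl := (t2 - t1) / 2.
have dl0 : 0 < dl by rewrite /dl; lra.
have key eta : 0 < eta -> eta < 1 ->
    fine (P EY) <= 4 * fine (P EZ) + (K%:R + 4 * #|I|%:R) * eta.
  (* The sharpness [k] is solved from [expR (- (k * dl)) = eta]. *)
  move=> eta0 eta1; pose k := - ln eta / dl.
  have k0 : 0 <= k by rewrite divr_ge0 ?ltW// oppr_gt0 ln_lt0// eta0.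
  have ke : expR (- (k * dl)) = eta.
    by rewrite /k divfK ?gt_eqF// opprK lnK.
  have := comparison_softmm t0 k0.
  set f := seval k t0 (softmm r).
  have bf : bounded_mfun f := bounded_mfun_eval k t0 _.
  have h1 : (1 - K%:R * eta) * fine (P EY) <= \int[P]_w f (Y w).
    rewrite -Rexp_indic// -RexpZ//; apply: le_Rexp => //.
    - exact: bounded_mfunZ.
    - exact: (bounded_mfun_comp mY bf).
    move=> w; rewrite indicE; have /andP[f0 f1] := softmm_itv k t0 r (Y w).
    case: (boolP (w \in EY)) => [|_]; last by rewrite mulr0.
    rewrite inE => -[i hi]; rewrite mulr1 -ke; apply: (softmm_ge k0 (i := i)).
    by move=> p /hi h; rewrite (le_trans h)// /t0 /dl; lra.
  have h2 : \int[P]_w f (Z w) <= fine (P EZ) + #|I|%:R * eta.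
    rewrite -Rexp_indic// -[X in _ + X](Rexp_cst P) -RexpD//; last exact:
      bounded_mfun_cst.
    apply: le_Rexp.
    - exact: (bounded_mfun_comp mZ bf).
    - apply: bounded_mfunD => //; exact: bounded_mfun_cst.
    move=> w; rewrite indicE; have /andP[f0 f1] := softmm_itv k t0 r (Z w).
    have N0 : 0 <= #|I|%:R * eta by rewrite mulr_ge0// ltW.
    case: (boolP (w \in EZ)) => [_|/negP wEZ]; first by rewrite (le_trans f1)// lerDl.
    rewrite add0r -ke; apply: softmm_le => // i.
    apply: contrapT => hi; apply: wEZ; rewrite inE; exists i => p rp.
    rewrite ltNge; apply/negP => h; apply: hi; exists p => //.
    by rewrite (le_trans _ h)// /t0 /dl; lra.
  move=> h3.
  have : K%:R * eta * fine (P EY) <= K%:R * eta.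
    by rewrite ler_piMr// mulr_ge0// ltW.
  lra.
apply/ler_addgt0Pr => e e0.
pose C : R := K%:R + 4 * #|I|%:R + 1.
have C0 : 0 < C by rewrite ltr_wpDl.
(* The bound [2^-1] keeps [eta] below 1, so that [ln eta] is negative and [k] nonnegative. *)
pose eta := Num.min (2^-1) (e / C).
have eta0 : 0 < eta by rewrite lt_min invr_gt0 ltr0n divr_gt0.
have eta1 : eta < 1 by rewrite gt_min; apply/orP; left; lra.
apply: (le_trans (key _ eta0 eta1)); rewrite lerD2l.
have h : C * eta <= e by rewrite mulrC -ler_pdivlMr// ge_min lexx orbT.
have : (K%:R + 4 * #|I|%:R) * eta <= C * eta by rewrite ler_wpM2r ?(ltW eta0)// lerDl.
by move=> h'; exact: le_trans h.
Qed.

End FiniteComparison.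

(** * From finitely many points to infima of suprema *)

Section Separable.
Context {R : realType}.

Definition separable_net (T : pseudoMetricType R) :=
  exists (Q : countType) (q : Q -> T), forall x e, 0 < e -> exists i, ball x e (q i).

Lemma separable_net_real : separable_net R.
Proof.
exists rat, ratr => x e e0.
have [q] : exists q : rat, x < ratr q < x + e.
  have [q /itvP h] := @rat_in_itvoo R x (x + e) (ltac:(by rewrite ltrDl)).
  by exists q; rewrite !h.
move=> /andP[h1 h2]; exists q; rewrite /ball /= distrC ger0_norm ?subr_ge0 ?ltW//.
by rewrite ltrBlDl.
Qed.

Lemma separable_net_prod (T1 T2 : pseudoMetricType R) :
  separable_net T1 -> separable_net T2 -> separable_net (T1 * T2)%type.
Proof.
move=> [Q1 [q1 h1]] [Q2 [q2 h2]].
exists (Q1 * Q2)%type, (fun i => (q1 i.1, q2 i.2)) => -[x1 x2] e e0.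
have [i1 b1] := h1 x1 e e0; have [i2 b2] := h2 x2 e e0.
by exists (i1, i2); split.
Qed.

Lemma separable_net_cV n : separable_net 'cV[R]_n.
Proof.
have [Q [q h]] := separable_net_real.
exists 'cV[Q]_n, (fun i => map_mx q i) => x e e0.
have [c hc] := choice (fun k => h (x k 0) e e0).
exists (\col_k c k); split => // i j.
by rewrite !mxE (ord1 j); exact: hc.
Qed.

(** Net points may lie outside [S]. For each net point and each radius [1 / k.+1], a point of [S]
    within that radius is chosen when there is one, and [s0] otherwise. *)
Lemma dense_sequence (T : pseudoMetricType R) (S : set T) :
  separable_net T -> S !=set0 ->
  exists s : nat -> T, (forall n, S (s n)) /\
    forall x e, S x -> 0 < e -> exists n, ball x e (s n).
Proof.
move=> [Q [q hq]] [s0 Ss0].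
have /choice[c hc] (ik : Q * nat) : exists y, S y /\
    ((exists2 y, S y & ball (q ik.1) ik.2.+1%:R^-1 y) ->
      ball (q ik.1) ik.2.+1%:R^-1 y).
  have [[y Sy hy]|h] := pselect (exists2 y, S y & ball (q ik.1) ik.2.+1%:R^-1 y).
    by exists y.
  by exists s0; split.
exists (fun n => if unpickle n is Some ik then c ik else s0); split.
  by move=> n; case: unpickle => [ik|//]; have [] := hc ik.
move=> x e Sx e0.
have e20 : 0 < e / 2 by rewrite divr_gt0.
have [k _ /(_ k (leqnn k)) /= hk] := near_infty_natSinv_lt (PosNum e20).
have k0 : 0 < k.+1%:R^-1 :> R by rewrite invr_gt0.
have [i hi] := hq x _ k0.
exists (pickle (i, k)); rewrite pickleK.
have [_ hb] := hc (i, k).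
apply: (@ball_split _ _ (q i)).
  exact: (le_ball (ltW hk) hi).
apply: (le_ball (ltW hk)); apply: hb => /=.
by exists x => //; exact: ball_sym.
Qed.


End Separable.

(** * Infima of suprema through dense sequences *)

Section InfSup.
Context {R : realType} {T1 T2 : pseudoMetricType R}.
Variables (K1 : set T1) (K2 : set T2) (p : nat -> T1) (q : nat -> T2).
Hypothesis cK1 : compact K1.
Hypotheses (K1p : forall i, K1 (p i)) (K2q : forall j, K2 (q j)).
Hypothesis dp : forall x e, K1 x -> 0 < e -> exists n, ball x e (p n).
Hypothesis dq : forall x e, K2 x -> 0 < e -> exists n, ball x e (q n).
Variable F : T1 -> T2 -> R.
Hypothesis F1 : forall x y e, K1 x -> K2 y -> 0 < e ->
  exists2 dl, 0 < dl & forall x', K1 x' -> ball x dl x' -> `|F x' y - F x y| < e.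
Hypothesis F2 : forall x y e, K1 x -> K2 y -> 0 < e ->
  exists2 dl, 0 < dl & forall y', K2 y' -> ball y dl y' -> `|F x y' - F x y| < e.
Variable t : R.

Definition infsup : \bar R :=
  ereal_inf [set ereal_sup [set (F x y)%:E | y in K2] | x in K1].

(** A near-minimizer [x] is moved to a nearby [p i]. Only finitely many [q j] are involved, so one
    radius serves them all. *)
Lemma infsup_le_dense (e : R) (n : nat) : (infsup <= t%:E)%E -> 0 < e ->
  exists i, forall j, (j < n)%N -> F (p i) (q j) < t + e.
Proof.
move=> h e0.
have : (infsup < (t + e / 2)%:E)%E.
  by apply: (le_lt_trans h); rewrite lte_fin ltrDl divr_gt0.
move=> /ereal_inf_lt[_ [x K1x <-] hx].
have {}hx j : F x (q j) < t + e / 2.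
  rewrite -lte_fin; apply: le_lt_trans hx; apply: ereal_sup_ubound.
  by exists (q j).
have [dl dl0 hdl] : exists2 dl, 0 < dl & forall j, (j < n)%N -> forall x',
    K1 x' -> ball x dl x' -> F x' (q j) < t + e.
  elim: n => [|n [dl dl0 IH]]; first by exists 1.
  have e20 : 0 < e / 2 by rewrite divr_gt0.
  have [dl' dl'0 h'] := F1 K1x (K2q n) e20.
  exists (Num.min dl dl'); first by rewrite lt_min dl0.
  move=> j; rewrite ltnS leq_eqVlt => /predU1P[->|jn] x' K1x' bx.
    have := h' x' K1x' (le_ball _ bx).
    rewrite ge_min lexx orbT => /(_ isT); rewrite ltr_norml => /andP[_].
    by have := hx n; lra.
  by apply: IH => //; apply: le_ball bx; rewrite ge_min lexx.
have [i hi] := dp K1x dl0.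
by exists i => j jn; exact: (hdl j jn).
Qed.

(** The point [p (i n)] depends on [n]; compactness of [K1] gives a cluster point [x] that satisfies
    all constraints at once. The error [e] is split in three: from [y] to [q j], from [x] to
    [p (i n)], and the slack. *)
Lemma dense_infsup_le (c : R) :
  (forall n, exists i, forall j, (j < n)%N -> F (p i) (q j) <= t + c / n.+1%:R) ->
  (infsup <= t%:E)%E.
Proof.
move=> /choice[i hi].
have FF : ProperFilter ((p \o i) @ \oo) by exact: fmap_proper_filter.
have [|x [K1x clx]] := cK1 FF.
  by exists 0%N => // n _ /=; exact: K1p.
have hx y : K2 y -> F x y <= t.
  move=> K2y; apply/ler_addgt0Pr => e e0.
  have e30 : 0 < e / 3 by rewrite divr_gt0.
  have [dl2 dl20 h2] := F2 K1x K2y e30.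
  have [j hj] := dq K2y dl20.
  have := h2 _ (K2q j) hj; rewrite ltr_norml => /andP[g1 g2].
  have [dl1 dl10 h1] := F1 K1x (K2q j) e30.
  have [n0 hn0] : exists n0 : nat, forall n, (n0 <= n)%N -> c / n.+1%:R <= e / 3.
    have d0 : 0 < e / 3 / (`|c| + 1) by rewrite divr_gt0// ltr_wpDl.
    have [n0 _ hn0] := near_infty_natSinv_lt (PosNum d0).
    exists n0 => n /hn0 /= /ltW hn.
    apply: (@le_trans _ _ ((`|c| + 1) / n.+1%:R)).
      by rewrite ler_wpM2r// (le_trans (ler_norm c))// lerDl.
    by rewrite mulrC -ler_pdivlMr// ltr_wpDl.
  (* From [n0] on the slack is at most [e / 3]; from [j.+1] on the constraint [q j] is among the
     first [n]. *)
  have [] := clx [set x' | exists2 n, (maxn n0 j.+1 <= n)%N & x' = p (i n)] (ball x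
    dl1).
  - by exists (maxn n0 j.+1) => // n /= hn; exists n.
  - exact: nbhsx_ballx.
  move=> _ [[n hn ->] bx].
  have := h1 _ (K1p (i n)) bx; rewrite ltr_norml => /andP[g3 g4].
  move: hn; rewrite geq_max => /andP[/hn0 g5 /(hi n j) g6].
  have arith (A B C D e' t' : R) : - (e' / 3) < B - A -> - (e' / 3) < C - B ->
    D <= e' / 3 -> C <= t' + D -> A <= t' + e' by move=> *; lra.
  exact: (arith _ _ _ _ _ _ g1 g3 g5 g6).
apply: (@le_trans _ _ (ereal_sup [set (F x y)%:E | y in K2])).
  by apply: ereal_inf_lbound; exists x.
by apply: ub_ereal_sup => _ [y K2y <-]; rewrite lee_fin hx.
Qed.

End InfSup.

(** * From finite to countable families of points *)

Section LimitComparison.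
Context {d} {Omega : measurableType d} {R : realType}.
Variables (P : probability Omega R) (FY FZ : nat -> nat -> Omega -> R).
Hypothesis mFY : forall i j, measurable_fun setT (FY i j).
Hypothesis mFZ : forall i j, measurable_fun setT (FZ i j).
Hypothesis fin_cmp : forall (N n : nat) (t1 t2 : R), t1 < t2 ->
  (P [set w | exists i : 'I_N, forall j : 'I_n, (FY i j w <= t1)%R] <=
   4%:E * P [set w | exists i : 'I_N, forall j : 'I_n, (FZ i j w < t2)%R])%E.
Variable t : R.

Definition level_le (F : nat -> nat -> Omega -> R) (s : R) (n : nat) : set Omega :=
  [set w | exists i, forall j, (j < n)%N -> F i j w <= s].
Definition level_lt (F : nat -> nat -> Omega -> R) (s : R) (n : nat) : set Omega :=
  [set w | exists i, forall j, (j < n)%N -> F i j w < s].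

Let measurable_row (F : nat -> nat -> Omega -> R) (Q : R -> bool) n i :
  (forall i j, measurable_fun setT (F i j)) -> measurable [set y | Q y] ->
  measurable [set w | forall j, (j < n)%N -> Q (F i j w)].
Proof.
move=> mF mQ.
rewrite (_ : [set w | _] = \bigcap_(j in `I_n) (F i j @^-1` [set y | Q y])).
  apply: fin_bigcap_measurable => [|j _]; first exact: finite_II.
  by rewrite -[X in measurable X]setTI; exact: mF.
by apply/seteqP; split => w h j /h.
Qed.

Let mle s : measurable [set y : R | y <= s].
Proof. rewrite -set_itvNyc; exact: measurable_itv. Qed.

Let mlt s : measurable [set y : R | y < s].
Proof. rewrite -set_itvNyo; exact: measurable_itv. Qed.

Let levelE (F : nat -> nat -> Omega -> R) (Q : R -> bool) n :
  [set w | exists i, forall j, (j < n)%N -> Q (F i j w)] =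
  \bigcup_i [set w | forall j, (j < n)%N -> Q (F i j w)].
Proof. by apply/seteqP; split => w [i]; [exists i|exists i]. Qed.

Lemma measurable_level_le s n : measurable (level_le FY s n).
Proof.
rewrite /level_le (levelE FY (fun y => y <= s)); apply: bigcupT_measurable => i.
exact: (measurable_row (Q := fun y => y <= s)).
Qed.

Lemma measurable_level_lt s n : measurable (level_lt FZ s n).
Proof.
rewrite /level_lt (levelE FZ (fun y => y < s)); apply: bigcupT_measurable => i.
exact: (measurable_row (Q := fun y => y < s)).
Qed.

(** The rows are let in one by one with [n] fixed: continuity from below on the [Y] side, while on
    the [Z] side every finite event lies in the full level. *)
Lemma level_comparison n t1 t2 : t1 < t2 ->
  (P (level_le FY t1 n) <= 4%:E * P (level_lt FZ t2 n))%E.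
Proof.
move=> t12.
pose E N := [set w | exists2 i, (i < N)%N & forall j, (j < n)%N -> FY i j w <= t1].
have EE N : E N = \bigcup_(i in `I_N) [set w | forall j, (j < n)%N -> FY i j w <= t1].
  by apply/seteqP; split => w [i]; exists i.
have mE N : measurable (E N).
  rewrite EE; apply: fin_bigcup_measurable => [|i _]; first exact: finite_II.
  exact: (measurable_row (Q := fun y => y <= t1)).
have UE : level_le FY t1 n = \bigcup_N E N.
  apply/seteqP; split => w.
    by move=> [i hi]; exists i.+1 => //; exists i.
  by move=> [N _ [i _ hi]]; exists i.
have mU : measurable (\bigcup_N E N) by exact: bigcupT_measurable.
have ndE : nondecreasing_seq E.
  move=> M N MN; apply/subsetPset => w [i iM hi]; exists i => //.
  exact: leq_trans MN.
have cv := nondecreasing_cvg_mu (mu := P) mE mU ndE.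
rewrite UE -(cvg_lim _ cv)//; apply: lime_le; first by apply/cvg_ex; eexists; exact: cv.
apply: nearW => N /=.
have := fin_cmp N n t12.
have -> : [set w | exists i : 'I_N, forall j : 'I_n, (FY i j w <= t1)%R] = E N.
  apply/seteqP; split => w /=.
    by move=> [i hi]; exists i => // j jn; exact: (hi (Ordinal jn)).
  by move=> [i iN hi]; exists (Ordinal iN) => j; exact: hi.
move/le_trans; apply; rewrite lee_pmul2l//.
have mZ : measurable [set w | exists i : 'I_N, forall j : 'I_n, FZ i j w < t2].
  rewrite (_ : [set w | _] = \bigcup_(i in `I_N) [set w | forall j, (j < n)%N -> FZ i
    j w < t2]).
    apply: fin_bigcup_measurable => [|i _]; first exact: finite_II.
    exact: (measurable_row (Q := fun y => y < t2)).
  apply/seteqP; split => w /=.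
    by move=> [i hi]; exists (val i) => /= [|j jn]; [exact: ltn_ord|exact: (hi
      (Ordinal jn))].
  by move=> [i iN hi]; exists (Ordinal iN) => j; exact: hi.
apply: le_measure; rewrite ?inE//; first exact: measurable_level_lt.
by move=> w [i hi]; exists i => j jn; exact: (hi (Ordinal jn)).
Qed.

(** Both slacks vanish in the limit, while at each [n] their difference is the strict gap required
    between the thresholds. The [Z] levels decrease in [n], so continuity from above applies; on the
    [Y] side the intersection lies in each level. *)
Lemma limit_comparison :
  (P (\bigcap_n level_le FY (t + n.+1%:R^-1) n) <=
   4%:E * P (\bigcap_n level_lt FZ (t + 2 / n.+1%:R) n))%E.
Proof.
have mI : measurable (\bigcap_n level_lt FZ (t + 2 / n.+1%:R) n).
  by apply: bigcapT_measurable => n; exact: measurable_level_lt.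
have mY : measurable (\bigcap_n level_le FY (t + n.+1%:R^-1) n).
  by apply: bigcapT_measurable => n; exact: measurable_level_le.
have ni : nonincreasing_seq (fun n => level_lt FZ (t + 2 / n.+1%:R) n).
  move=> m n mn; apply/subsetPset => w [i hi]; exists i => j jm.
  apply: (lt_le_trans (hi j (leq_trans jm mn))).
  by rewrite lerD2l ler_pM2l// lef_pV2 ?posrE// ler_nat.
have cv := nonincreasing_cvg_mu (mu := P) _ (fun n => measurable_level_lt (t + 2 /
  n.+1%:R) n) mI ni.
have {}cv := cv (le_lt_trans (probability_le1 P (measurable_level_lt _ _)) (ltry _)).
have {}cv : (4%:E * P (level_lt FZ (t + 2 / n.+1%:R) n) @[n --> \oo] -->
  4%:E * P (\bigcap_n level_lt FZ (t + 2 / n.+1%:R) n))%E by apply: cvgeZl.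
rewrite -(cvg_lim _ cv)//; apply: lime_ge; first by apply/cvg_ex; eexists; exact: cv.
apply: nearW => n; apply: (@le_trans _ _ (P (level_le FY (t + n.+1%:R^-1) n))).
  apply: le_measure; rewrite ?inE//; first exact: measurable_level_le.
  exact: bigcap_inf.
by apply: level_comparison; rewrite ltrD2l ltr_pMl ?invr_gt0// ltr1n.
Qed.

End LimitComparison.

(** * The processes Y and Z *)

Section Dot.
Context {R : realType}.

Lemma dotE n (u v : 'cV[R]_n) : dot u v = \sum_i u i 0 * v i 0.
Proof. by rewrite /dot mxE; apply: eq_bigr => i _; rewrite mxE. Qed.

Lemma dotC n (u v : 'cV[R]_n) : dot u v = dot v u.
Proof. by rewrite !dotE; apply: eq_bigr => i _; rewrite mulrC. Qed.

Lemma dotDl n (u v w : 'cV[R]_n) : dot (u + v) w = dot u w + dot v w.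
Proof. by rewrite !dotE -big_split; apply: eq_bigr => i _; rewrite mxE mulrDl. Qed.

Lemma dotZl n c (u v : 'cV[R]_n) : dot (c *: u) v = c * dot u v.
Proof. by rewrite !dotE mulr_sumr; apply: eq_bigr => i _; rewrite mxE mulrA. Qed.

Lemma dotDr n (u v w : 'cV[R]_n) : dot w (u + v) = dot w u + dot w v.
Proof. by rewrite dotC dotDl !(dotC _ w). Qed.

Lemma dotZr n c (u v : 'cV[R]_n) : dot v (c *: u) = c * dot v u.
Proof. by rewrite dotC dotZl dotC. Qed.

Lemma enorm_ge0 n (u : 'cV[R]_n) : 0 <= enorm u.
Proof. exact: sqrtr_ge0. Qed.

Lemma dot_enorm n (u : 'cV[R]_n) : dot u u = enorm u * enorm u.
Proof.
rewrite -expr2 sqr_sqrtr ?dotE; last by apply: sumr_ge0 => i _; exact: sqr_ge0.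
by apply: eq_bigr => i _; rewrite expr2.
Qed.

Lemma enorm_eq0 n (u : 'cV[R]_n) : enorm u = 0 -> u = 0.
Proof.
move=> u0; apply/matrixP => i j; rewrite (ord1 j) mxE.
have : \sum_i u i 0 * u i 0 = 0 by rewrite -dotE dot_enorm u0 mulr0.
move/eqP; rewrite psumr_eq0 => [/allP /(_ i)|k _]; last by rewrite -expr2 sqr_ge0.
by rewrite mem_index_enum => /(_ isT); rewrite mulf_eq0 orbb => /eqP.
Qed.

Lemma dot_le n (u v : 'cV[R]_n) : dot u v <= enorm u * enorm v.
Proof.
have [/enorm_eq0 ->|u0] := eqVneq (enorm u) 0.
  rewrite -(scale0r (0 : 'cV[R]_n)) dotZl mul0r mulr_ge0 ?enorm_ge0//.
have [/enorm_eq0 ->|v0] := eqVneq (enorm v) 0.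
  rewrite -(scale0r (0 : 'cV[R]_n)) dotZr mul0r mulr_ge0 ?enorm_ge0//.
have uv : 0 < enorm u * enorm v by rewrite mulr_gt0// lt_neqAle eq_sym enorm_ge0 ?u0
  ?v0.
pose w := enorm v *: u + - enorm u *: v.
have : 0 <= dot w w by rewrite dot_enorm mulr_ge0 ?enorm_ge0.
rewrite /w !(dotDl, dotDr, dotZl, dotZr) !dot_enorm (dotC v u).
move: uv; move: (enorm u) (enorm v) (dot u v) => A B D AB.
set E := (X in 0 <= X).
have -> : E = 2 * (A * B) * (A * B - D) by rewrite /E; ring.
have AB2 : 0 < 2 * (A * B) by exact: mulr_gt0.
by rewrite (pmulr_rge0 _ AB2) subr_ge0.
Qed.

Lemma normr_dot_le n (u v : 'cV[R]_n) : `|dot u v| <= enorm u * enorm v.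
Proof.
rewrite ler_norml dot_le andbT lerNl -mulN1r -dotZl (le_trans (dot_le _ _))//.
rewrite (_ : enorm (-1 *: u) = enorm u)//.
by congr Num.sqrt; apply: eq_bigr => i _; rewrite mxE mulN1r sqrrN.
Qed.

End Dot.

(** * Coefficients and covariances of the two processes *)

Section Coefficients.
Context {R : realType} {m n : nat}.
Variables (theta nu : R).
Local Notation index := (('I_m * 'I_n) + ('I_m + ('I_m + 'I_n)))%type.
Implicit Types (a b : 'cV[R]_n) (u : 'cV[R]_m) (gamma : R).

(* The processes Y and Z are linear combinations of the entries of (G, g, f, h);
   here a stands for x - r Z(x) and b for Z(x). *)
Definition ycoef a b u gamma (k : index) : R :=
  match k with
  | inl ij => u ij.1 0 * (a + gamma *: b) ij.2 0
  | inr _ => 0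
  end.

Definition zcoef a b u gamma (k : index) : R :=
  match k with
  | inl _ => 0
  | inr (inl i) => (enorm a + gamma * theta * enorm b) * u i 0
  | inr (inr (inl i)) => gamma * nu * enorm b * u i 0
  | inr (inr (inr j)) => - (enorm u * (a + `|gamma| *: b) j 0)
  end.

(** A deterministic identity, stated with [entries] over the one-point space [unit] so that it can
    be used at each outcome separately. *)
Lemma sum_ycoef (G : 'M[R]_(m, n)) g f h a b u gamma :
  \sum_k entries (fun _ : unit => G) (fun=> g) (fun=> f) (fun=> h) k tt * ycoef a b u
    gamma k =
  dot u (G *m a) + gamma * dot u (G *m b).
Proof.
rewrite big_sumType /= [X in _ + X]big1 ?addr0 => [|k _]; last by rewrite mulr0.
rewrite -dotZr -dotDr scalemxAr -mulmxDr.
rewrite -(pair_bigA _ (fun i j => G i j * (u i 0 * (a + gamma *: b) j 0))) dotE /=.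
apply: eq_bigr => i _; rewrite [in RHS]mxE mulr_sumr; apply: eq_bigr => j _.
by rewrite mulrCA.
Qed.

Lemma sum_zcoef (G : 'M[R]_(m, n)) g f h a b u gamma :
  \sum_k entries (fun _ : unit => G) (fun=> g) (fun=> f) (fun=> h) k tt * zcoef a b u
    gamma k =
  enorm a * dot g u - enorm u * dot h a
  + gamma * enorm b * dot (theta *: g + nu *: f) u
  - `|gamma| * enorm u * dot h b.
Proof.
rewrite !big_sumType /= [X in X + _]big1 ?add0r => [|k _]; last by rewrite mulr0.
rewrite dotDl !dotZl.
have -> : \sum_i g i 0 * ((enorm a + gamma * theta * enorm b) * u i 0) =
  (enorm a + gamma * theta * enorm b) * dot g u.
  by rewrite dotE mulr_sumr; apply: eq_bigr => i _; rewrite mulrCA.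
have -> : \sum_i f i 0 * (gamma * nu * enorm b * u i 0) =
  gamma * nu * enorm b * dot f u.
  by rewrite dotE mulr_sumr; apply: eq_bigr => i _; rewrite mulrCA.
have -> : \sum_j h j 0 * - (enorm u * (a + `|gamma| *: b) j 0) =
  - enorm u * (dot h a + `|gamma| * dot h b).
  rewrite -dotZr -dotDr dotE mulr_sumr; apply: eq_bigr => j _.
  by rewrite mulrN mulrCA mulNr.
ring.
Qed.

Lemma cov_ycoef a b u gamma a' b' u' gamma' :
  \sum_k ycoef a b u gamma k * ycoef a' b' u' gamma' k =
  dot u u' * (dot a a' + gamma' * dot a b' + gamma * dot b a' + gamma * gamma' * dot
    b b').
Proof.
rewrite big_sumType /= [X in _ + X]big1 ?addr0 => [|k _]; last by rewrite mulr0.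
have -> : dot a a' + gamma' * dot a b' + gamma * dot b a' + gamma * gamma' * dot b b' =
  dot (a + gamma *: b) (a' + gamma' *: b').
  by rewrite !(dotDl, dotDr, dotZl, dotZr); ring.
rewrite -(pair_bigA _ (fun i j => u i 0 * (a + gamma *: b) j 0 *
  (u' i 0 * (a' + gamma' *: b') j 0))) /=.
rewrite !dotE mulr_suml; apply: eq_bigr => i _; rewrite mulr_sumr.
by apply: eq_bigr => j _; rewrite mulrACA.
Qed.

Lemma cov_zcoef a b u gamma a' b' u' gamma' :
  \sum_k zcoef a b u gamma k * zcoef a' b' u' gamma' k =
  dot u u' * ((enorm a + gamma * theta * enorm b) * (enorm a' + gamma' * theta *
    enorm b')
     + gamma * gamma' * nu ^+ 2 * (enorm b * enorm b'))
  + enorm u * enorm u' * (dot a a' + `|gamma'| * dot a b' + `|gamma| * dot b a'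
     + `|gamma| * `|gamma'| * dot b b').
Proof.
rewrite !big_sumType /= [X in X + _]big1 ?add0r => [|k _]; last by rewrite mulr0.
have -> : dot a a' + `|gamma'| * dot a b' + `|gamma| * dot b a' + `|gamma| *
  `|gamma'| * dot b b' =
  dot (a + `|gamma| *: b) (a' + `|gamma'| *: b').
  by rewrite !(dotDl, dotDr, dotZl, dotZr); ring.
rewrite mulrDr addrA; congr (_ + _ + _).
- rewrite dotE mulr_suml; apply: eq_bigr => i _; ring.
- rewrite dotE mulr_suml; apply: eq_bigr => i _; ring.
- by rewrite dotE mulr_sumr; apply: eq_bigr => i _; rewrite mulrNN mulrACA.
Qed.

(* Coefficients of the two Gaussians added to Y; they are nonnegative because
   theta >= 0. *)
Definition extra1 a b u gamma : R := enorm u * (enorm a + `|gamma| * theta * enorm b).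
Definition extra2 b u gamma : R := enorm u * (`|gamma| * nu * enorm b).

(** The equality case of [cov_le_diff]: for equal [a] and equal [b], the four defects [al], [be],
    [be'], [de] appearing there are zero. *)
Lemma cov_eq_same a b u gamma u' gamma' : theta ^+ 2 + nu ^+ 2 = 1 ->
  dot a b = theta * enorm a * enorm b ->
  extra1 a b u gamma * extra1 a b u' gamma' + extra2 b u gamma * extra2 b u' gamma'
  + \sum_k ycoef a b u gamma k * ycoef a b u' gamma' k =
  \sum_k zcoef a b u gamma k * zcoef a b u' gamma' k.
Proof.
move=> tn ab; rewrite cov_ycoef cov_zcoef (dotC b a) ab !dot_enorm /extra1 /extra2.
have -> : enorm u * (`|gamma| * nu * enorm b) * (enorm u' * (`|gamma'| * nu * enorm
  b)) =
  enorm u * enorm u' * `|gamma| * `|gamma'| * enorm b * enorm b * nu ^+ 2 by ring.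
have -> : nu ^+ 2 = 1 - theta ^+ 2 by rewrite -tn addrAC subrr add0r.
ring.
Qed.

(** The covariances differ by [|u| |u'|] times a combination of four nonnegative defects with
    weights [1], [|gamma'|], [|gamma|], [|gamma gamma'|], minus [u.u'] times the same combination
    with signed weights. Cauchy-Schwarz and the triangle inequality conclude. *)
Lemma cov_le_diff a b u gamma a' b' u' gamma' : theta ^+ 2 + nu ^+ 2 = 1 ->
  dot a b' <= theta * enorm a * enorm b' -> dot b a' <= theta * enorm b * enorm a' ->
  \sum_k zcoef a b u gamma k * zcoef a' b' u' gamma' k <=
  extra1 a b u gamma * extra1 a' b' u' gamma' + extra2 b u gamma * extra2 b' u' gamma'
  + \sum_k ycoef a b u gamma k * ycoef a' b' u' gamma' k.
Proof.
move=> tn ab ba; rewrite cov_ycoef cov_zcoef /extra1 /extra2.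
have n2 : nu ^+ 2 = 1 - theta ^+ 2 by rewrite -tn addrAC subrr add0r.
have -> : enorm u * (`|gamma| * nu * enorm b) * (enorm u' * (`|gamma'| * nu * enorm
  b')) =
  enorm u * enorm u' * `|gamma| * `|gamma'| * enorm b * enorm b' * nu ^+ 2 by ring.
rewrite n2.
pose al := enorm a * enorm a' - dot a a'.
pose be := theta * enorm a * enorm b' - dot a b'.
pose be' := theta * enorm b * enorm a' - dot b a'.
pose de := enorm b * enorm b' - dot b b'.
have al0 : 0 <= al by rewrite subr_ge0 dot_le.
have be0 : 0 <= be by rewrite subr_ge0.
have be'0 : 0 <= be' by rewrite subr_ge0.
have de0 : 0 <= de by rewrite subr_ge0 dot_le.
rewrite -subr_ge0.
set D := (X in 0 <= X).
have -> : D = enorm u * enorm u' * (al + `|gamma'| * be + `|gamma| * be' + `|gamma| *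
  `|gamma'| * de)
  - dot u u' * (al + gamma' * be + gamma * be' + gamma * gamma' * de).
  by rewrite /D /al /be /be' /de; ring.
rewrite subr_ge0; apply: (le_trans (ler_norm _)); rewrite normrM.
apply: ler_pM => //; first exact: normr_dot_le.
apply: (le_trans (ler_normD _ _)); apply: lerD; last first.
  by rewrite !normrM (ger0_norm de0).
apply: (le_trans (ler_normD _ _)); apply: lerD; last first.
  by rewrite normrM (ger0_norm be'0).
apply: (le_trans (ler_normD _ _)); apply: lerD; first by rewrite ger0_norm.
by rewrite normrM (ger0_norm be0).
Qed.

End Coefficients.

(** * Geometry of the feasible set *)

Section FeasibleSet.
Context {R : realType} {n : nat}.
Variables (L r theta : R).
Hypotheses (L0 : 0 < L) (r0 : 0 < r).
Implicit Types x y : 'cV[R]_n.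
Local Notation S := (Sxtheta n L r theta).
Local Notation shifted x := (x - r *: calZ L x).

Lemma calZE x i : calZ L x i 0 = L * Num.sg (x i 0).
Proof. by rewrite !mxE. Qed.

(** Feasible points have no zero entry, so [|Z(x)|] is the same for all of them; this lets [|Z(x)|]
    be traded for [|Z(y)|] in [dot_shifted_calZ_le]. *)
Lemma enorm_calZ x : S x -> enorm (calZ L x) = Num.sqrt (\sum_(i < n) L ^+ 2).
Proof.
move=> [x0 _ _ _]; congr Num.sqrt; apply: eq_bigr => i _.
by rewrite calZE exprMn sqr_sg x0 mulr1.
Qed.

(* Outside ]- L r, L r[ the entries of x - r Z(x) keep the sign of those of x. *)
Lemma shifted_sign x i : S x -> shifted x i 0 * Num.sg (x i 0) = `|shifted x i 0|.
Proof.
move=> [x0 _ _ /(_ i) xi]; rewrite !mxE -/(Num.sg _).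
have Lr : 0 < L * r by rewrite mulr_gt0.
move: xi; rewrite in_itv /= negb_and -!leNgt => /orP[h|h].
  have xi0 : x i 0 < 0 by rewrite (le_lt_trans h)// oppr_lt0.
  rewrite ltr0_sg// !mulrN1 mulrN opprK mulrC ler0_norm//.
  by rewrite mulrC mulrC; lra.
have xi0 : 0 < x i 0 by rewrite (lt_le_trans Lr).
rewrite gtr0_sg// !mulr1 ger0_norm//; lra.
Qed.

(** Since the nonzero entries of [shifted x] have the signs of those of [x], the sign vector of [x]
    maximizes the product with [shifted x]: it gives the sum of the absolute values. *)
Lemma dot_shifted_le x y : S x -> S y ->
  dot (shifted x) (calZ L y) <= dot (shifted x) (calZ L x).
Proof.
move=> Sx Sy; rewrite !dotE; apply: ler_sum => i _.
rewrite !calZE mulrCA [leRHS]mulrCA ler_pM2l// shifted_sign//.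
apply: (le_trans (ler_norm _)); rewrite normrM normr_sg.
by case: (_ != 0); rewrite ?mulr1// mulr0.
Qed.

Lemma dot_shifted_calZ x : S x ->
  dot (shifted x) (calZ L x) = theta * enorm (shifted x) * enorm (calZ L x).
Proof.
move=> Sx; have [x0 xn <- _] := Sx.
have a0 : enorm (shifted x) != 0.
  by apply/eqP => /enorm_eq0 /eqP; rewrite subr_eq0 => /eqP.
(* If [Z(x) = 0], any entry contradicts [Rstar x]; in dimension 0, where there is no entry,
   [x = r Z(x)] contradicts [xn]. *)
have b0 : enorm (calZ L x) != 0.
  apply/eqP => /enorm_eq0 b0; apply: xn; rewrite b0 scaler0.
  apply/matrixP => i j; rewrite (ord1 j) [RHS]mxE.
  have := x0 i; rewrite -sgr_eq0 => /eqP; case.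
  by apply: (mulfI (lt0r_neq0 L0)); rewrite -calZE b0 mxE mulr0.
by rewrite /rho -mulrA divfK// mulf_neq0.
Qed.

Lemma theta_ge0 x : S x -> 0 <= theta.
Proof.
move=> Sx; have [x0 xn <- _] := Sx.
rewrite divr_ge0 ?mulr_ge0 ?enorm_ge0// dotE sumr_ge0// => i _.
by rewrite calZE mulrCA mulr_ge0 ?(ltW L0)// shifted_sign.
Qed.

Lemma dot_shifted_calZ_le x y : S x -> S y ->
  dot (shifted x) (calZ L y) <= theta * enorm (shifted x) * enorm (calZ L y).
Proof.
move=> Sx Sy; rewrite (enorm_calZ Sy) -(enorm_calZ Sx) -dot_shifted_calZ//.
exact: dot_shifted_le.
Qed.

End FeasibleSet.

(** * Continuity of the processes on the feasible set *)

Section WithinContinuity.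
Context {R : realType} {T : pseudoMetricType R}.
Variable S : set T.
Implicit Types f g : T -> R.
Local Notation cts f := {within S, continuous (f : T -> R)}.

Lemma within_cst c : cts (fun=> c).
Proof. by move=> x; exact: cvg_cst. Qed.

Lemma withinD f g : cts f -> cts g -> cts (fun x => f x + g x).
Proof. by move=> cf cg x; apply: cvgD; [exact: cf|exact: cg]. Qed.

Lemma withinM f g : cts f -> cts g -> cts (fun x => f x * g x).
Proof. by move=> cf cg x; apply: cvgM; [exact: cf|exact: cg]. Qed.

Lemma withinN f : cts f -> cts (fun x => - f x).
Proof. by move=> cf x; apply: cvgN; exact: cf. Qed.

Lemma within_norm f : cts f -> cts (fun x => `|f x|).
Proof. by move=> cf x; apply: cvg_norm; exact: cf. Qed.

Lemma within_sqrt f : cts f -> cts (fun x => Num.sqrt (f x)).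
Proof.
move=> cf x; apply: (cvg_comp f Num.sqrt); first exact: cf.
exact: sqrt_continuous.
Qed.

Lemma within_sum (I : Type) (s : seq I) (F : I -> T -> R) :
  (forall i, cts (F i)) -> cts (fun x => \sum_(i <- s) F i x).
Proof.
move=> cF; elim: s => [|i s IH].
  by under eq_fun do rewrite big_nil; exact: within_cst.
by under eq_fun do rewrite big_cons; exact: withinD.
Qed.

Lemma within_enorm n (F : T -> 'cV[R]_n) : (forall i, cts (fun x => F x i 0)) ->
  cts (fun x => enorm (F x)).
Proof.
move=> cF; apply: within_sqrt; apply: within_sum => i.
by under eq_fun do rewrite expr2; exact: withinM.
Qed.

(** The sign is locally constant away from 0. Through it [Z(x)], and with it both processes, is
    continuous within the feasible set, where no entry vanishes. *)
Lemma within_sg f : cts f -> (forall x, S x -> f x != 0) -> cts (fun x => Num.sg (f x)).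
Proof.
move=> cf f0; apply/subspace_continuousP => x Sx.
have := cf; move/subspace_continuousP => /(_ x Sx) cx.
have fx0 := f0 x Sx.
have near_sg : \forall y \near within S (nbhs x), Num.sg (f y) = Num.sg (f x).
  have fx : 0 < `|f x| by rewrite normr_gt0.
  have hn : \forall y \near within S (nbhs x), `|f x - f y| < `|f x|.
    exact: (@cvgr_dist_lt _ _ _ _ _ _ _ cx _ fx).
  apply: filterS hn => y; move: (f y) (f x) fx0 => u v v0.
  rewrite ltr_norml; have [v0'|v0'|v0'] := ltgtP v 0; last by rewrite v0' eqxx in v0.
    rewrite ltr0_norm// => /andP[h1 h2]; rewrite !ltr0_sg//; lra.
  rewrite gtr0_norm// => /andP[h1 h2]; rewrite !gtr0_sg//; lra.
exact: (cvg_near_cst (Num.sg (f x)) near_sg).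
Qed.

Lemma within_ball f x e : cts f -> S x -> 0 < e ->
  exists2 dl, 0 < dl & forall y, S y -> ball x dl y -> `|f y - f x| < e.
Proof.
move=> /subspace_continuousP cf Sx e0.
have : \forall y \near within S (nbhs x), `|f x - f y| < e.
  exact: (@cvgr_dist_lt _ _ _ _ _ _ _ (cf x Sx) _ e0).
rewrite near_withinE => /nbhs_ballP[dl /= dl0 h].
by exists dl => // y Sy bxy; rewrite distrC; exact: h.
Qed.

End WithinContinuity.

Section ProcessContinuity.
Context {R : realType} {m n : nat}.
Variables (L r theta nu : R).
Variables (Sd Su : set 'cV[R]_m) (Sx : set 'cV[R]_n) (Sg : set R).
Hypothesis Sx_star : Sx `<=` @Rstar R n.
Local Notation T := ('cV[R]_m * 'cV[R]_n * 'cV[R]_m * R)%type.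
Local Notation S := (Sd `*` Sx `*` Su `*` Sg).
Local Notation cts f := {within S, continuous (f : T -> R)}.
Local Notation index := (('I_m * 'I_n) + ('I_m + ('I_m + 'I_n)))%type.
Local Notation b z := (calZ L z.1.1.2).
Local Notation a z := (z.1.1.2 - r *: calZ L z.1.1.2).

Lemma within_x i : cts (fun z => z.1.1.2 i 0).
Proof.
apply: continuous_subspaceT => z.
apply: (continuous_comp (f := fun z : T => z.1.1.2) (g := fun x : 'cV[R]_n => x i 0)).
  apply: (continuous_comp (f := fun z : T => z.1.1) (g := snd)); last exact: cvg_snd.
  apply: (continuous_comp (f := fun z : T => z.1) (g := fst)); last exact: cvg_fst.
  exact: cvg_fst.
exact: coord_continuous.
Qed.

Lemma within_u i : cts (fun z => z.1.2 i 0).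
Proof.
apply: continuous_subspaceT => z.
apply: (continuous_comp (f := fun z : T => z.1.2) (g := fun x : 'cV[R]_m => x i 0)).
  apply: (continuous_comp (f := fun z : T => z.1) (g := snd)); last exact: cvg_snd.
  exact: cvg_fst.
exact: coord_continuous.
Qed.

Lemma within_gamma : cts (fun z => z.2).
Proof. by apply: continuous_subspaceT => z; exact: cvg_snd. Qed.

Lemma within_b i : cts (fun z => b z i 0).
Proof.
under eq_fun do rewrite calZE.
apply: withinM; first exact: within_cst.
apply: within_sg; first exact: within_x.
by move=> z [[[_ Sxz] _] _]; exact: (Sx_star Sxz).
Qed.

Lemma within_a i : cts (fun z => a z i 0).
Proof.
rewrite (_ : (fun _ => _) = fun z : T => z.1.1.2 i 0 + - (r * b z i 0)).
  apply: withinD; first exact: within_x.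
  by apply: withinN; apply: withinM; [exact: within_cst|exact: within_b].
by apply/funext => z; rewrite !mxE.
Qed.


Lemma within_ycoef (k : index) : cts (fun z => ycoef (a z) (b z) z.1.2 z.2 k).
Proof.
case: k => [[i j]|k] /=; last exact: within_cst.
apply: withinM; first exact: within_u.
under eq_fun do rewrite mxE [X in _ + X]mxE.
apply: withinD; first exact: within_a.
by apply: withinM; [exact: within_gamma|exact: within_b].
Qed.

Lemma within_zcoef (k : index) :
  cts (fun z => zcoef theta nu (a z) (b z) z.1.2 z.2 k).
Proof.
have ca : cts (fun z => enorm (a z)) by apply: within_enorm; exact: within_a.
have cb : cts (fun z => enorm (b z)) by apply: within_enorm; exact: within_b.
have cu : cts (fun z => enorm z.1.2) by apply: within_enorm; exact: within_u.
case: k => [k|[i|[i|j]]] /=; first exact: within_cst.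
- apply: withinM; last exact: within_u.
  apply: withinD => //; apply: withinM => //.
  by apply: withinM; [exact: within_gamma|exact: within_cst].
- apply: withinM; last exact: within_u.
  apply: withinM => //; apply: withinM; last exact: within_cst.
  exact: within_gamma.
- apply: withinN; apply: withinM => //.
  under eq_fun do rewrite mxE [X in _ + X]mxE.
  apply: withinD; first exact: within_a.
  apply: withinM; last exact: within_b.
  by apply: within_norm; exact: within_gamma.
Qed.

Lemma within_procY (G : 'M[R]_(m, n)) psi : cts psi ->
  cts (fun z => procY L r G psi z.1.1.1 z.1.1.2 z.1.2 z.2).
Proof.
move=> cpsi; apply: withinD; last by
  rewrite (_ : (fun _ => _) = psi)//; apply/funext => -[[[]]].
under eq_fun do rewrite -(sum_ycoef G 0 0 0).
apply: within_sum => k; apply: withinM; first exact: within_cst.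
exact: within_ycoef.
Qed.

Lemma within_procZ (g f : 'cV[R]_m) (h : 'cV[R]_n) psi : cts psi ->
  cts (fun z => procZ L r theta nu g f h psi z.1.1.1 z.1.1.2 z.1.2 z.2).
Proof.
move=> cpsi; apply: withinD; last by
  rewrite (_ : (fun _ => _) = psi)//; apply/funext => -[[[]]].
under eq_fun do rewrite -(sum_zcoef theta nu 0 g f h).
apply: within_sum => k; apply: withinM; first exact: within_cst.
exact: within_zcoef.
Qed.

End ProcessContinuity.

Section MinMax.
Context {R : realType} {m n : nat}.
Variables (Sd Su : set 'cV[R]_m) (Sx : set 'cV[R]_n) (Sg : set R).
Local Notation T := ('cV[R]_m * 'cV[R]_n * 'cV[R]_m * R)%type.
Local Notation S := (Sd `*` Sx `*` Su `*` Sg).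

Lemma minmax_infsup (F : 'cV[R]_m -> 'cV[R]_n -> 'cV[R]_m -> R -> R) :
  minmax Sd Sx Su Sg F =
  infsup (Sd `*` Sx) (Su `*` Sg) (fun dx ug => F dx.1 dx.2 ug.1 ug.2).
Proof.
congr ereal_inf; apply/seteqP; split => y /=.
  move=> [d Sdd [x Sxx <-]]; exists (d, x) => //=.
  congr ereal_sup; apply/seteqP; split => z /=.
    by move=> [[u g] [/= Suu Sgg] <-]; exists u => //; exists g.
  by move=> [u Suu [g Sgg <-]]; exists (u, g).
move=> [[d x] [/= Sdd Sxx] <-]; exists d => //; exists x => //.
congr ereal_sup; apply/seteqP; split => z /=.
  by move=> [u Suu [g Sgg <-]]; exists (u, g).
by move=> [[u g] [/= Suu Sgg] <-]; exists u => //; exists g.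
Qed.

Variable F : 'cV[R]_m -> 'cV[R]_n -> 'cV[R]_m -> R -> R.
Hypothesis cF : {within S, continuous (fun z : T => F z.1.1.1 z.1.1.2 z.1.2 z.2)}.

Lemma minmax_continuous_outer dx ug e : (Sd `*` Sx) dx -> (Su `*` Sg) ug -> 0 < e ->
  exists2 dl, 0 < dl & forall dx', (Sd `*` Sx) dx' -> ball dx dl dx' ->
    `|F dx'.1 dx'.2 ug.1 ug.2 - F dx.1 dx.2 ug.1 ug.2| < e.
Proof.
move: dx ug => [d x] [u g] [Sdd Sxx] [Suu Sgg] e0.
have Sz : S (d, x, u, g) by [].
have [dl dl0 h] := within_ball cF Sz e0.
exists dl => // -[d' x'] [Sdd' Sxx'] [bd bx].
apply: (h (d', x', u, g)); first by [].
by split => /=; [split=> /=; [split|exact: ballxx]|exact: ballxx].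
Qed.

Lemma minmax_continuous_inner dx ug e : (Sd `*` Sx) dx -> (Su `*` Sg) ug -> 0 < e ->
  exists2 dl, 0 < dl & forall ug', (Su `*` Sg) ug' -> ball ug dl ug' ->
    `|F dx.1 dx.2 ug'.1 ug'.2 - F dx.1 dx.2 ug.1 ug.2| < e.
Proof.
move: dx ug => [d x] [u g] [Sdd Sxx] [Suu Sgg] e0.
have Sz : S (d, x, u, g) by [].
have [dl dl0 h] := within_ball cF Sz e0.
exists dl => // -[u' g'] [Suu' Sgg'] [bu bg].
apply: (h (d, x, u', g')); first by [].
by split => /=; [split=> /=; [exact: ballxx|]|].
Qed.

End MinMax.

(** * The min-max events as countable combinations *)

Section MinMaxEvents.
Context {d : measure_display} {Omega : measurableType d} {R : realType} {m n : nat}.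
Variables (Sd Su : set 'cV[R]_m) (Sx : set 'cV[R]_n) (Sg : set R).
Local Notation T := ('cV[R]_m * 'cV[R]_n * 'cV[R]_m * R)%type.
Variables (p : nat -> 'cV[R]_m * 'cV[R]_n) (q : nat -> 'cV[R]_m * R).
Hypothesis cK1 : compact (Sd `*` Sx).
Hypotheses (K1p : forall i, (Sd `*` Sx) (p i)) (K2q : forall j, (Su `*` Sg) (q j)).
Hypothesis dp : forall x e, (Sd `*` Sx) x -> 0 < e -> exists n, ball x e (p n).
Hypothesis dq : forall x e, (Su `*` Sg) x -> 0 < e -> exists n, ball x e (q n).
Variable F : Omega -> 'cV[R]_m -> 'cV[R]_n -> 'cV[R]_m -> R -> R.
Hypothesis cF : forall w, {within Sd `*` Sx `*` Su `*` Sg,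
  continuous (fun z : T => F w z.1.1.1 z.1.1.2 z.1.2 z.2)}.
Local Notation FF := (fun i j w => F w (p i).1 (p i).2 (q j).1 (q j).2).

(** The event itself, with no loss of probability, is expressed by conditions on countably many
    values of the process. [minmax_level_lt] describes the same kind of event with twice the slack,
    as [limit_comparison] requires for [Z]. *)
Lemma minmax_level_le (t : R) : [set w | (minmax Sd Sx Su Sg (F w) <= t%:E)%E] =
  \bigcap_k level_le FF (t + k.+1%:R^-1) k.
Proof.
apply/seteqP; split => w /=.
  rewrite minmax_infsup => h k _; have k0 : 0 < k.+1%:R^-1 :> R by rewrite invr_gt0.
  have [i hi] := infsup_le_dense K1p K2q dp (minmax_continuous_outer (@cF w)) k h k0.
  by exists i => j jk; rewrite ltW// hi.
move=> h; rewrite minmax_infsup.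
apply: (dense_infsup_le cK1 K1p K2q dq (minmax_continuous_outer (@cF w))
  (minmax_continuous_inner (@cF w)) (c := 1)) => k.
by have [i hi] := h k I; exists i => j jk; rewrite mul1r; exact: hi.
Qed.

Lemma minmax_level_lt (t : R) : [set w | (minmax Sd Sx Su Sg (F w) <= t%:E)%E] =
  \bigcap_k level_lt FF (t + 2 / k.+1%:R) k.
Proof.
apply/seteqP; split => w /=.
  rewrite minmax_infsup => h k _; have k0 : 0 < 2 / k.+1%:R :> R by rewrite divr_gt0.
  have [i hi] := infsup_le_dense K1p K2q dp (minmax_continuous_outer (@cF w)) k h k0.
  by exists i.
move=> h; rewrite minmax_infsup.
apply: (dense_infsup_le cK1 K1p K2q dq (minmax_continuous_outer (@cF w))
  (minmax_continuous_inner (@cF w)) (c := 2)) => k.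
by have [i hi] := h k I; exists i => j jk; rewrite ltW// hi.
Qed.

End MinMaxEvents.

(** * The finite comparison applied to the two processes *)

Section ProcessComparison.
Context {R : realType} {disp : measure_display} {Omega : measurableType disp}.
Variables (P : probability Omega R) (m n : nat) (L r theta nu : R).
Hypotheses (L0 : 0 < L) (r0 : 0 < r) (tn : theta ^+ 2 + nu ^+ 2 = 1) (nu0 : 0 <= nu).
Variables (Sd Su : set 'cV[R]_m) (Sx : set 'cV[R]_n) (Sg : set R).
Hypothesis Sx_sub : Sx `<=` Sxtheta n L r theta.
Hypothesis Sx_neq0 : Sx !=set0.
Variables (G : Omega -> 'M[R]_(m, n)) (g f : Omega -> 'cV[R]_m) (h : Omega -> 'cV[R]_n).
Hypothesis gaussian : iid_std_gaussian P (entries G g f h).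
Variable psi : Omega -> 'cV[R]_m * 'cV[R]_n * 'cV[R]_m * R -> R.
Local Notation S := (Sd `*` Sx `*` Su `*` Sg).
Hypothesis psi_measurable : forall a, S a -> measurable_fun setT (fun w => psi w a).
Hypothesis psi_independent : independent_families P S setT (fun a w => psi w a)
  (entries G g f h).
Variables (p : nat -> 'cV[R]_m * 'cV[R]_n) (q : nat -> 'cV[R]_m * R).
Hypotheses (K1p : forall i, (Sd `*` Sx) (p i)) (K2q : forall j, (Su `*` Sg) (q j)).

Local Notation index := (('I_m * 'I_n) + ('I_m + ('I_m + 'I_n)))%type.
Local Notation b i := (calZ L (p i).2).
Local Notation a i := ((p i).2 - r *: b i).
Local Notation xi := (entries G g f h).
Local Notation FY := (fun i j w => procY L r (G w) (psi w) (p i).1 (p i).2 (q j).1 (q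
  j).2).
Local Notation FZ := (fun i j w => procZ L r theta nu (g w) (f w) (h w) (psi w)
  (p i).1 (p i).2 (q j).1 (q j).2).
Local Notation pt i j := ((p i).1, (p i).2, (q j).1, (q j).2).

Let Spt i j : S (pt i j).
Proof. by have [? ?] := K1p i; have [? ?] := K2q j. Qed.

Lemma procY_entries i j w : FY i j w =
  psi w (pt i j) + \sum_k xi k w * ycoef (a i) (b i) (q j).1 (q j).2 k.
Proof.
by rewrite /procY addrC -(sum_ycoef _ (g w) (f w) (h w)); congr (_ + _).
Qed.

Lemma procZ_entries i j w : FZ i j w =
  psi w (pt i j) + \sum_k xi k w * zcoef theta nu (a i) (b i) (q j).1 (q j).2 k.
Proof.
by rewrite /procZ addrC -(sum_zcoef theta nu (G w)); congr (_ + _).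
Qed.

Let mxi k : measurable_fun setT (xi k). Proof. by case: gaussian. Qed.

Lemma measurable_procY i j : measurable_fun setT (FY i j).
Proof.
have mS : measurable_fun setT
    (fun w => \sum_k xi k w * ycoef (a i) (b i) (q j).1 (q j).2 k).
  by apply: measurable_sum => k; exact: measurable_funM.
apply: eq_measurable_fun (measurable_funD (psi_measurable (Spt i j)) mS).
by move=> w _; rewrite /= procY_entries.
Qed.

Lemma measurable_procZ i j : measurable_fun setT (FZ i j).
Proof.
have mS : measurable_fun setT
    (fun w => \sum_k xi k w * zcoef theta nu (a i) (b i) (q j).1 (q j).2 k).
  by apply: measurable_sum => k; exact: measurable_funM.
apply: eq_measurable_fun (measurable_funD (psi_measurable (Spt i j)) mS).
by move=> w _; rewrite /= procZ_entries.
Qed.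

Lemma finite_process_comparison (N M : nat) (t1 t2 : R) : t1 < t2 ->
  (P [set w | exists i : 'I_N, forall j : 'I_M, (FY i j w <= t1)%R] <=
   4%:E * P [set w | exists i : 'I_N, forall j : 'I_M, (FZ i j w < t2)%R])%E.
Proof.
move=> t12.
(* One coordinate for each pair of an outer and an inner point. The row map is [ro], so coordinates
   of one row share [(d, x)]. *)
pose K := #|{: 'I_N * 'I_M}|.
pose V := K.-tuple (measurableTypeR R).
pose ro (k : 'I_K) : 'I_N := (enum_val k).1.
pose co (k : 'I_K) : 'I_M := (enum_val k).2.
pose W0 (w : Omega) : V := [tuple psi w (pt (ro k) (co k)) | k < K].
pose cY l : V := [tuple ycoef (a (ro k)) (b (ro k)) (q (co k)).1 (q (co k)).2 l | k <
  K].
pose cZ l : V :=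
  [tuple zcoef theta nu (a (ro k)) (b (ro k)) (q (co k)).1 (q (co k)).2 l | k < K].
pose c1 : V := [tuple extra1 theta (a (ro k)) (b (ro k)) (q (co k)).1 (q (co k)).2 |
  k < K].
pose c2 : V := [tuple extra2 nu (b (ro k)) (q (co k)).1 (q (co k)).2 | k < K].
have tE (X : 'I_K -> R) k : tcoord ([tuple X k | k < K] : V) k = X k.
  by rewrite /tcoord tnth_mktuple.
have th0 : 0 <= theta.
  by have [x /Sx_sub Sxx] := Sx_neq0; exact: (theta_ge0 L0 r0 Sxx).
have Sp i : Sxtheta n L r theta (p i).2 by apply: Sx_sub; have [] := K1p i.
(* Chosen so that [<<s G0 >>] is [sigma_gen] of the values of [psi] on the feasible set;
   [psi_independent] is then the required independence as it stands. *)
pose G0 : set (set Omega) :=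
  \bigcup_(z in S) preimage_set_system setT (fun w => psi w z) measurable.
have G0m : <<s G0 >> `<=` measurable.
  apply: smallest_sub; first exact: sigma_algebra_measurable.
  by move=> _ [z Sz [B mB <-]]; exact: psi_measurable.
have W0m k (B : set R) : measurable B -> <<s G0 >> ((fun w => tcoord (W0 w) k) @^-1` B).
  move=> mB; apply: sub_sigma_algebra; exists (pt (ro k) (co k)); first exact: Spt.
  exists B => //; rewrite setTI; apply/seteqP; split => w /=; by rewrite tE.
have cmp := @finite_comparison _ _ _ _ _ _ P G0 W0 xi G0m W0m gaussian psi_independent
  ro cY cZ c1 c2 _ _ _ _ t1 t2 t12.
have EY w k : tcoord (gaussian_sum W0 xi cY (enum {: index}) w) k = FY (ro k) (co k) w.
  rewrite procY_entries tE tE; congr (_ + _).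
  by rewrite big_enum; apply: eq_bigr => l _; rewrite tE.
have EZ w k : tcoord (gaussian_sum W0 xi cZ (enum {: index}) w) k = FZ (ro k) (co k) w.
  rewrite procZ_entries tE tE; congr (_ + _).
  by rewrite big_enum; apply: eq_bigr => l _; rewrite tE.
have rowE (Q : R -> Prop) (F : nat -> nat -> R) :
    (exists i : 'I_N, forall j : 'I_M, Q (F i j)) <->
    (exists i, forall k, ro k = i -> Q (F (ro k) (co k))).
  split=> -[i hi]; exists i; first by move=> k ki; rewrite ki; exact: hi.
  move=> j; have := hi (enum_rank (i, j)).
  by rewrite /ro /co enum_rankK; exact.
have -> : [set w | exists i : 'I_N, forall j : 'I_M, FY i j w <= t1] =
    [set w | exists i, forall k, ro k = i -> tcoord (gaussian_sum W0 xi cY (enum {: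
      index}) w) k <= t1].
  apply/seteqP; split => w /=.
    move/(rowE (fun y => y <= t1) (fun i j => FY i j w)) => [i hi].
    by exists i => k ki; rewrite EY; exact: hi.
  move=> [i hi]; apply/(rowE (fun y => y <= t1) (fun i j => FY i j w)); exists i => k
    ki.
  by rewrite -EY; exact: hi.
have -> : [set w | exists i : 'I_N, forall j : 'I_M, FZ i j w < t2] =
    [set w | exists i, forall k, ro k = i -> tcoord (gaussian_sum W0 xi cZ (enum {:
      index}) w) k < t2].
  apply/seteqP; split => w /=.
    move/(rowE (fun y => y < t2) (fun i j => FZ i j w)) => [i hi].
    by exists i => k ki; rewrite EZ; exact: hi.
  move=> [i hi]; apply/(rowE (fun y => y < t2) (fun i j => FZ i j w)); exists i => k ki.
  by rewrite -EZ; exact: hi.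
apply: cmp.
- by move=> k; rewrite tE !(mulr_ge0, addr_ge0, enorm_ge0).
- by move=> k; rewrite tE !(mulr_ge0, enorm_ge0).
- move=> k l kl; rewrite !tE kl.
  under eq_bigr do rewrite !tE kl.
  under [RHS]eq_bigr do rewrite !tE kl.
  by apply: cov_eq_same => //; exact: dot_shifted_calZ.
(* Different rows may still carry the same [x]; the inequality holds for every pair of feasible
   points. *)
- move=> k l _; rewrite !tE.
  under eq_bigr do rewrite !tE.
  under [X in _ <= _ + X]eq_bigr do rewrite !tE.
  apply: cov_le_diff => //; first exact: dot_shifted_calZ_le.
  rewrite dotC (le_trans (dot_shifted_calZ_le L0 r0 (Sp _) (Sp _)))//.
  by rewrite mulrAC.
Qed.

End ProcessComparison.

Theorem theorem10 (R : realType) (disp : measure_display)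
  (Omega : measurableType disp) (P : probability Omega R)
  (m n : nat) (L r theta nu : R)
  (hL : 0 < L) (hr : 0 < r) (htheta : -1 <= theta <= 1)
  (hnu : nu = Num.sqrt (1 - theta ^+ 2))
  (Sd Su : set 'cV[R]_m) (Sx : set 'cV[R]_n) (Sgamma : set R)
  (Sd_compact : compact Sd) (Su_compact : compact Su)
  (Sx_compact : compact Sx) (Sx_sub : Sx `<=` Sxtheta n L r theta)
  (Sgamma_compact_or_full : compact Sgamma \/ Sgamma = setT)
  (Sd_neq0 : Sd !=set0) (Su_neq0 : Su !=set0) (Sx_neq0 : Sx !=set0)
  (Sgamma_neq0 : Sgamma !=set0)
  (G : Omega -> 'M[R]_(m, n)) (g f : Omega -> 'cV[R]_m) (h : Omega -> 'cV[R]_n)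
  (gaussian : iid_std_gaussian P (entries G g f h))
  (psi : Omega -> 'cV[R]_m * 'cV[R]_n * 'cV[R]_m * R -> R)
  (psi_continuous : forall w,
     {within Sd `*` Sx `*` Su `*` Sgamma, continuous (psi w)})
  (psi_measurable : forall a, (Sd `*` Sx `*` Su `*` Sgamma) a ->
     measurable_fun setT (fun w => psi w a))
  (psi_independent : independent_families P
     (Sd `*` Sx `*` Su `*` Sgamma) setT
     (fun a w => psi w a) (entries G g f h))
  (t : R) :
  (P [set w | minmax Sd Sx Su Sgamma (procY L r (G w) (psi w)) <= t%:E]
   <= 4%:E *
      P [set w | minmax Sd Sx Su Sgamma
                   (procZ L r theta nu (g w) (f w) (h w) (psi w)) <= t%:E])%E.
Proof.
have tn : theta ^+ 2 + nu ^+ 2 = 1.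
  rewrite hnu sqr_sqrtr; first by rewrite addrC subrK.
  by have /andP[? ?] := htheta; nra.
have nu0 : 0 <= nu by rewrite hnu sqrtr_ge0.
have Sx_star : Sx `<=` @Rstar R n by move=> x /Sx_sub[].
have K1_neq0 : Sd `*` Sx !=set0.
  by have [d ?] := Sd_neq0; have [x ?] := Sx_neq0; exists (d, x).
have K2_neq0 : Su `*` Sgamma !=set0.
  by have [u ?] := Su_neq0; have [c ?] := Sgamma_neq0; exists (u, c).
have cK1 : compact (Sd `*` Sx) by exact: compact_setX.
have [p [K1p dp]] := dense_sequence
  (separable_net_prod (separable_net_cV m) (separable_net_cV n)) K1_neq0.
have [q [K2q dq]] := dense_sequence
  (separable_net_prod (separable_net_cV m) (@separable_net_real R)) K2_neq0.
have cY w : {within Sd `*` Sx `*` Su `*` Sgamma, continuous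
    (fun z => procY L r (G w) (psi w) z.1.1.1 z.1.1.2 z.1.2 z.2)}.
  exact: within_procY.
have cZ w : {within Sd `*` Sx `*` Su `*` Sgamma, continuous
    (fun z => procZ L r theta nu (g w) (f w) (h w) (psi w) z.1.1.1 z.1.1.2 z.1.2 z.2)}.
  exact: within_procZ.
rewrite (minmax_level_le cK1 K1p K2q dp dq cY).
rewrite (minmax_level_lt cK1 K1p K2q dp dq cZ).
apply: limit_comparison => [i j|i j|N M t1 t2].
- exact: (measurable_procY L r gaussian psi_measurable K1p K2q).
- exact: (measurable_procZ L r theta nu gaussian psi_measurable K1p K2q).
- exact: (finite_process_comparison hL hr tn nu0 Sx_sub Sx_neq0 gaussian
    psi_measurable psi_independent K1p K2q).
Qed.
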